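(* Let $\rho$ be a retraction of $\mathcal I$ centered at a positive sector-germ, let $A=\rho(\mathcal I)$, let $B$ be an apartment of $\mathcal I$, and let $d_A$ (resp. $d_B$) be a distance on $A$ (resp. $B$) induced by a norm. Then: 1. for all $\theta\in\Theta_+$, the map $\rho:(\mathcal I,d_\theta)\to(A,d_A)$ is Lipschitz; 2. the map $\rho|_B:(B,d_B)\to(A,d_A)$ is Lipschitz.
   Context: **Vectorial data.** $I$ is a finite set and $C=(c_{i,j})_{i,j\in I}$ is a Kac--Moody matrix: $c_{i,j}\in\mathbb Z$, $c_{i,i}=2$, $c_{i,j}\le 0$ for $i\neq j$, and $c_{i,j}=0\iff c_{j,i}=0$. $X,Y$ are dual free $\mathbb Z$-modules of finite rank with $\mathbb Z$-linearly independent families $(\alpha_i)_{i\in I}$ in $X$ and $(\alpha_i^\vee)_{i\in I}$ in $Y$ such that $\alpha_j(\alpha_i^\vee)=c_{i,j}$. $\mathbb A=Y\otimes\mathbb R$, with its usual topology; elements of $X$ are linear forms on $\mathbb A$. $r_i(v)=v-\alpha_i(v)\alpha_i^\vee$, and $W^v=\langle r_i\mid i\in I\rangle\subset \mathrm{GL}(\mathbb A)$ (Weyl group), acting on $\mathbb A^*$ by $(w.\alpha)(x)=\alpha(w^{-1}x)$. $\Phi=\{w.\alpha_i\}$ is the set of real roots; for $\alpha=w.\alpha_i\in\Phi$, $\alpha^\vee=w.\alpha_i^\vee$. $Q^\vee=\bigoplus_i\mathbb Z\alpha_i^\vee$ and $W^a=Q^\vee\rtimes W^v$. $\Delta\subset\bigoplus_i\mathbb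 Z\alpha_i\subset\mathbb A^*$ is the set of all (real and imaginary) roots of the Kac--Moody algebra of $C$. For $\alpha\in\mathbb A^*$, $k\in\mathbb R$: $D(\alpha,k)=\{\alpha(x)+k\ge0\}$, $D^\circ(\alpha,k)=\{\alpha(x)+k>0\}$, $M(\alpha,k)=\{\alpha(x)+k=0\}$, and $D(\alpha,+\infty)=D^\circ(\alpha,+\infty)=\mathbb A$. Walls (resp. half-apartments) are the $M(\alpha,k)$ (resp. $D(\alpha,k)$), $\alpha\in\Phi$, $k\in\mathbb Z$. $C^v_f=\{v\mid\alpha_i(v)>0\ \forall i\}$; for $J\subset I$, $F^v(J)=\{v\mid \alpha_i(v)=0\ (i\in J),\ \alpha_i(v)>0\ (i\notin J)\}$. Positive (resp. negative) vectorial faces are the $w.F^v(J)$ (resp. $-w.F^v(J)$), $w\in W^v$; vectorial chambers are the $\pm w.C^v_f$. Tits cone: $\mathcal T=\bigcup_{w}w.\overline{C^v_f}$. A vectorial face is spherical if it meets $\pm\mathring{\mathcal T}$. $x\le y$ means $y-x\in\mathcal T$. A ray or segment through $x\ne y$ from $x$ is preordered if $x\le y$ or $y\le x$, generic if $y-x\in\pm\mathring{\mathcal T}$. **Filters.** A filter lies in a set $Z$ if $Z$ is an element of it; a set (e.g. an apartment) contains a filter if it contains an element of it; a map fixes a filter if it fixes pointwise some element of it. The support of a filter is the smallest affine subspace containing it. $\mathcal F\Cup\mathcal F'=\{E\cup E'\mid E\in\mathcal F,E'\in\mathcal F'\}$. The enclosure $\mathrm{cl}(\mathcal F)$ of a filter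 on $\mathbb A$ is the filter of sets $E$ containing some $\bigcap_{\alpha\in\Delta}D(\alpha,k_\alpha)\in\mathcal F$ with $k_\alpha\in\mathbb Z\cup\{+\infty\}$ (a set is treated as its principal filter). A sector-face is $f=x+F^v$ ($F^v$ a vectorial face); its germ at infinity is the filter of sets containing $x+u+F^v$ for some $u\in\overline{F^v}$. If $F^v$ is a vectorial chamber, $f$ is a sector and its germ is a sector-germ, with the sign of $F^v$; $\pm\infty$ is the germ of $\pm C^v_f$. The face $F(x,F^v)$ is the filter of sets $E$ for which there are $k_\alpha,k'_\alpha\in\mathbb Z\cup\{+\infty\}$ $(\alpha\in\Delta)$ and a neighbourhood $\Omega$ of $x$ with $E\supset\bigcap_{\alpha}(D(\alpha,k_\alpha)\cap D^\circ(\alpha,k'_\alpha))\supset\Omega\cap(x+F^v)$. A chamber (resp. panel) is a face with support $\mathbb A$ (resp. a wall). A chimney is $\mathfrak r(F,F^v)=\mathrm{cl}(F+F^v)$, $F$ a face, $F^v$ a vectorial face; it is splayed if $F^v$ is spherical, solid if the pointwise stabilizer in $W^v$ of the direction of its support is finite. Its germ is the filter of sets belonging to some $\mathfrak r(F+u,F^v)$, $u\in\overline{F^v}$. **Apartments.** $\mathrm{Aut}(\mathbb A)$ is the group of affine bijections of $\mathbb A$ stabilizing $\{(M(\alpha,k),\alpha^\vee)\mid\alpha\in\Phi,k\in\mathbb Z\}$. An apartment of type $\mathbb A$ is a set $A$ with a nonempty set $\mathrm{Isom}^w(\mathbb A,A)$ of bijections $\mathbb A\to A$ forming one orbit $f_0\circ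 W^a$. A bijection $\phi:A\to A'$ is a Weyl isomorphism (resp. an isomorphism, which here always means vectorially Weyl isomorphism) if $f'^{-1}\circ\phi\circ f\in W^a$ (resp. $\in(W^v\ltimes\mathbb A)\cap\mathrm{Aut}(\mathbb A)$) for $f\in\mathrm{Isom}^w(\mathbb A,A)$, $f'\in\mathrm{Isom}^w(\mathbb A,A')$. All above notions, the affine structure and the affine topology are transported to every apartment. A distance on an apartment is induced by a norm if it is $(x,y)\mapsto\|x-y\|$ for a norm on its underlying vector space. **Masure.** A masure of type $\mathbb A$ is a set $\mathcal I$ covered by a family of subsets called apartments such that: (MA1) each apartment has a structure of apartment of type $\mathbb A$. (MA2) If $F$ is a point, a germ of a preordered interval, a generic ray or a solid chimney in an apartment $A$, and $A'$ is another apartment containing $F$, then $A\cap A'$ contains $\mathrm{cl}_A(F)$ and there is a Weyl isomorphism $A\to A'$ fixing $\mathrm{cl}_A(F)$. (MA3) If $\mathfrak R$ is the germ of a splayed chimney and $F$ is a face or a germ of a solid chimney, some apartment contains $\mathfrak R$ and $F$. (MA4) If apartments $A,A'$ contain $\mathfrak R$ and $F$ as in (MA3), there is a Weyl isomorphism $A\to A'$ fixing $\mathrm{cl}_A(\mathfrak R\Cup F)$. (MAO) If $x,y\in A\cap A'$ and $x\le_A y$ then $[x,y]_A=[x,y]_{A'}$. Standing assumptions: $\mathcal I$ is such a masure; each panel lies in the closure of finitely many, and more than $2$, chambers; a group $G$ acts strongly transitively on $\mathcal I$ (it permutes apartments, each $g:A\to g.A$ is an isomorphism of apartments, and all isomorphisms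 in the axioms are induced by elements of $G$); $\mathbb A$ is identified with a fixed apartment of $\mathcal I$, and the stabilizer of $\mathbb A$ in $G$ induces on $\mathbb A$ the group $W^v\ltimes Y$. $\mathcal I$ is a building if and only if $W^v$ is finite. Sector-germs of $\mathcal I$ are sector-germs of its apartments (a sector-germ contained in an apartment $B$ is a sector-germ of $B$, of the same sign). **Retractions.** If apartments $A,B$ contain a common sector-germ $\mathfrak s$, there is a unique isomorphism $A\to B$ fixing $\mathfrak s$ (it fixes $A\cap B$ pointwise). If $A$ contains $\mathfrak s$, the retraction onto $A$ centered at $\mathfrak s$ sends $x\in\mathcal I$ to the image of $x$ under the isomorphism $A_x\to A$ fixing $\mathfrak s$, where $A_x$ is any apartment containing $x$ and $\mathfrak s$ (it exists, and the image is independent of the choice). **Distances.** Let $\mathfrak s$ be a sector-germ of sign $\mathrm{sgn}(\mathfrak s)\in\{+,-\}$, $x\in\mathcal I$, $u\in\overline{C^v_f}$. Choose an apartment $A_1$ containing $x$ and $\mathfrak s$ and an isomorphism $\psi:\mathbb A\to A_1$ with $\psi(\mathrm{sgn}(\mathfrak s)\infty)=\mathfrak s$; then $x+_{\mathfrak s}u:=\psi(\psi^{-1}(x)+\mathrm{sgn}(\mathfrak s)u)$ is independent of choices. $U_{\mathfrak s}(x,x')=\{(u,u')\in\overline{C^v_f}^2\mid x+_{\mathfrak s}u=x'+_{\mathfrak s}u'\}$, which is nonempty. $\Theta_+$ (resp. $\Theta_-$) is the set of pairs $\theta=(|\cdot|,\mathfrak s)$ with $|\cdot|$ a norm on $\mathbb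 A$ and $\mathfrak s$ a positive (resp. negative) sector-germ of $\mathcal I$. For such $\theta$, $d_\theta(x,x')=\inf\{|u|+|u'|\mid(u,u')\in U_{\mathfrak s}(x,x')\}$ is a distance on $\mathcal I$. *)

(* Defs.v *)
From HB Require Import structures.
From mathcomp Require Import all_boot all_order all_algebra.
From mathcomp Require Import complex.
From mathcomp Require Import all_classical all_reals all_analysis.

Set Implicit Arguments.
Unset Strict Implicit.
Unset Printing Implicit Defensive.

Import Order.TTheory GRing.Theory Num.Theory.
Import numFieldNormedType.Exports.

Local Open Scope classical_set_scope.
Local Open Scope ring_scope.

(* Coordinates: Y = Z^n is the module of integer rows, X = Z^n the module of
   integer columns, and the pairing is the row-by-column product.  Thus
   Y (x) R = 'rV[R]_n, its dual is 'cV[R]_n, and an endomorphism is a matrix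
   acting on rows from the right. *)

Record root_datum (I : finType) (n : nat) := RootDatum {
  cartan : I -> I -> int;
  sroot : I -> 'cV[int]_n;
  scoroot : I -> 'rV[int]_n;
  cartan_diag : forall i, cartan i i = 2;
  cartan_le0 : forall i j, i != j -> cartan i j <= 0;
  cartan_eq0 : forall i j, cartan i j = 0 <-> cartan j i = 0;
  sroot_free : forall z : I -> int,
    \sum_i z i *: sroot i = 0 -> forall i, z i = 0;
  scoroot_free : forall z : I -> int,
    \sum_i z i *: scoroot i = 0 -> forall i, z i = 0;
  pairing_cartan : forall i j, (scoroot i *m sroot j) 0 0 = cartan i j
}.

Section KacMoodyAlgebra.
Variables (R : realType) (I : finType) (n : nat) (D : root_datum I n).

(* The complex Kac-Moody algebra with Cartan subalgebra Y (x) C, presented by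
   the Chevalley generators and the Serre relations: its elements are the
   expressions below modulo the congruence [km_eq]. *)
Inductive km_expr : Type :=
| KMh of 'rV[R[i]]_n
| KMe of I
| KMf of I
| KMzero
| KMadd of km_expr & km_expr
| KMscale of R[i] & km_expr
| KMbr of km_expr & km_expr.

Inductive km_eq : km_expr -> km_expr -> Prop :=
| km_refl x : km_eq x x
| km_sym x y : km_eq x y -> km_eq y x
| km_trans x y z : km_eq x y -> km_eq y z -> km_eq x z
| km_add_congr x x' y y' :
    km_eq x x' -> km_eq y y' -> km_eq (KMadd x y) (KMadd x' y')
| km_scale_congr c x x' : km_eq x x' -> km_eq (KMscale c x) (KMscale c x')
| km_br_congr x x' y y' :
    km_eq x x' -> km_eq y y' -> km_eq (KMbr x y) (KMbr x' y')
| km_addA x y z : km_eq (KMadd x (KMadd y z)) (KMadd (KMadd x y) z)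
| km_addC x y : km_eq (KMadd x y) (KMadd y x)
| km_add0 x : km_eq (KMadd KMzero x) x
| km_addN x : km_eq (KMadd (KMscale (-1) x) x) KMzero
| km_scaleA a b x : km_eq (KMscale a (KMscale b x)) (KMscale (a * b) x)
| km_scale1 x : km_eq (KMscale 1 x) x
| km_scaleDr a x y :
    km_eq (KMscale a (KMadd x y)) (KMadd (KMscale a x) (KMscale a y))
| km_scaleDl a b x :
    km_eq (KMscale (a + b) x) (KMadd (KMscale a x) (KMscale b x))
| km_brDl x y z : km_eq (KMbr (KMadd x y) z) (KMadd (KMbr x z) (KMbr y z))
| km_brDr x y z : km_eq (KMbr x (KMadd y z)) (KMadd (KMbr x y) (KMbr x z))
| km_brZl a x y : km_eq (KMbr (KMscale a x) y) (KMscale a (KMbr x y))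
| km_brZr a x y : km_eq (KMbr x (KMscale a y)) (KMscale a (KMbr x y))
| km_brxx x : km_eq (KMbr x x) KMzero
| km_jacobi x y z :
    km_eq (KMadd (KMbr x (KMbr y z))
                 (KMadd (KMbr y (KMbr z x)) (KMbr z (KMbr x y)))) KMzero
| km_hD h h' : km_eq (KMh (h + h')) (KMadd (KMh h) (KMh h'))
| km_hZ a h : km_eq (KMh (a *: h)) (KMscale a (KMh h))
| km_hh h h' : km_eq (KMbr (KMh h) (KMh h')) KMzero
| km_he h i : km_eq (KMbr (KMh h) (KMe i))
    (KMscale ((h *m map_mx intr (sroot D i)) 0 0) (KMe i))
| km_hf h i : km_eq (KMbr (KMh h) (KMf i))
    (KMscale (- (h *m map_mx intr (sroot D i)) 0 0) (KMf i))
| km_ef i : km_eq (KMbr (KMe i) (KMf i)) (KMh (map_mx intr (scoroot D i)))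
| km_ef0 i j : i != j -> km_eq (KMbr (KMe i) (KMf j)) KMzero
| km_serre_e i j : i != j ->
    km_eq (iter `|1 - cartan D i j|%N (KMbr (KMe i)) (KMe j)) KMzero
| km_serre_f i j : i != j ->
    km_eq (iter `|1 - cartan D i j|%N (KMbr (KMf i)) (KMf j)) KMzero.

(* The set Delta of real and imaginary roots. *)
Definition all_roots : set 'cV[int]_n :=
  [set a | [/\ a != 0,
    exists z : I -> int, a = \sum_i z i *: sroot D i
  & exists x, ~ km_eq x KMzero /\
      forall h : 'rV[R[i]]_n,
        km_eq (KMbr (KMh h) x) (KMscale ((h *m map_mx intr a) 0 0) x)]].

End KacMoodyAlgebra.

Section ModelApartment.
Variables (R : realType) (I : finType) (n : nat) (D : root_datum I n).

Local Notation AA := 'rV[R]_n.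

Definition pairing (x : AA) (a : 'cV[R]_n) : R := (x *m a) 0 0.

Definition srootR i : 'cV[R]_n := map_mx intr (sroot D i).
Definition scorootR i : AA := map_mx intr (scoroot D i).

(* x *m reflection i = x - alpha_i(x) alpha_i^vee. *)
Definition reflection i : 'M[R]_n := 1%:M - srootR i *m scorootR i.

(* The r_i are involutions, so the monoid they generate is a group. *)
Inductive weyl : 'M[R]_n -> Prop :=
| weyl1 : weyl 1%:M
| weylM i w : weyl w -> weyl (w *m reflection i).

(* The pairs (alpha, alpha^vee), alpha a real root.  As w acts on rows by
   x |-> x *m w, the form (w.a)(x) = a(w^-1 x) is the column invmx w *m a. *)
Definition real_roots : set ('cV[R]_n * AA) :=
  [set p | exists w i, weyl w /\ p = (invmx w *m srootR i, scorootR i *m w)].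

Definition affmap (w : 'M[R]_n) (t : AA) : AA -> AA := fun x => x *m w + t.

(* T ><| W^v, for T a set of translation vectors. *)
Definition weyl_affine (T : set AA) : set (AA -> AA) :=
  [set a | exists w t, [/\ weyl w, T t & a = affmap w t]].

Definition coroot_lattice : set AA :=
  [set t | exists z : I -> int, t = map_mx intr (\sum_i z i *: scoroot D i)].

Definition Ylattice : set AA := [set t | exists y : 'rV[int]_n, t = map_mx intr y].

Definition affine_weyl : set (AA -> AA) := weyl_affine coroot_lattice.

Definition wall (a : 'cV[R]_n) (k : int) : set AA :=
  [set x | pairing x a + k%:~R = 0].

Definition walls_coroots : set (set AA * AA) :=
  [set p | exists a av k, real_roots (a, av) /\ p = (wall a k, av)].

Definition Aut_apartment : set (AA -> AA) :=
  [set a | exists M t, [/\ M \in unitmx, a = affmap M t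
    & [set (a @` p.1, p.2 *m M) | p in walls_coroots] = walls_coroots]].

(* The vectorially Weyl automorphisms. *)
Definition vweyl_aut : set (AA -> AA) := weyl_affine setT `&` Aut_apartment.

(* D(a,k) and its open version; [None] stands for k = +oo. *)
Definition halfspace (a : 'cV[R]_n) (k : option int) : set AA :=
  [set x | if k is Some k' then 0 <= pairing x a + k'%:~R else True].
Definition ohalfspace (a : 'cV[R]_n) (k : option int) : set AA :=
  [set x | if k is Some k' then 0 < pairing x a + k'%:~R else True].

Definition Cvf : set AA := [set v | forall i, 0 < pairing v (srootR i)].

Definition std_face (J : {set I}) : set AA :=
  [set v | forall i, if i \in J then pairing v (srootR i) = 0
                     else 0 < pairing v (srootR i)].

(* A sign is a boolean: [true] for +, [false] for -. *)
Definition sgn (eps : bool) : R := if eps then 1 else -1.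

Definition vface : set (set AA) :=
  [set Fv | exists eps w J,
    weyl w /\ Fv = [set sgn eps *: (v *m w) | v in std_face J]].

Definition vchamber (eps : bool) : set (set AA) :=
  [set Cv | exists w, weyl w /\ Cv = [set sgn eps *: (v *m w) | v in Cvf]].

Definition tits_cone : set AA :=
  [set x | exists v w, [/\ closure Cvf v, weyl w & x = v *m w]].

(* The union of the interiors of the Tits cone and of its opposite. *)
Definition generic_cone : set AA :=
  [set v | tits_cone° v \/ tits_cone° (- v)].

Definition spherical (Fv : set AA) : Prop := Fv `&` generic_cone !=set0.

(* A filter is the set of its elements; those defined below are closed under
   supersets, so "Z contains F" and "F lies in Z" both read F Z. *)
Local Notation filt T := (set (set T)).

Definition principal (Z : set AA) : filt AA := [set E | Z `<=` E].

Definition affine_subspace : set (set AA) :=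
  [set Z | exists (x : AA) (M : 'M[R]_n), Z = [set y | (y - x <= M)%MS]].

Definition support (F : filt AA) : set AA :=
  \bigcap_(Z in affine_subspace `&` F) Z.

Definition direction (Z : set AA) : set AA :=
  [set v | exists x y, [/\ Z x, Z y & v = x - y]].

Definition root_inter (k : 'cV[int]_n -> option int) : set AA :=
  \bigcap_(a in all_roots R D) halfspace (map_mx intr a) (k a).

Definition root_ointer (k k' : 'cV[int]_n -> option int) : set AA :=
  \bigcap_(a in all_roots R D)
    (halfspace (map_mx intr a) (k a) `&` ohalfspace (map_mx intr a) (k' a)).

(* The enclosure cl(F). *)
Definition encl (F : filt AA) : filt AA :=
  [set E | exists k, root_inter k `<=` E /\ F (root_inter k)].

Definition translate (x : AA) (Z : set AA) : set AA := [set x + v | v in Z].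

Definition germ_infty (x : AA) (Fv : set AA) : filt AA :=
  [set E | exists u, closure Fv u /\ translate (x + u) Fv `<=` E].

Definition face_filter (x : AA) (Fv : set AA) : filt AA :=
  [set E | exists k k' Om, [/\ nbhs x Om, root_ointer k k' `<=` E
     & Om `&` translate x Fv `<=` root_ointer k k']].

Definition face : set (filt AA) :=
  [set F | exists x Fv, vface Fv /\ F = face_filter x Fv].

Definition chamber : set (filt AA) := [set F | face F /\ support F = setT].

Definition panel : set (filt AA) :=
  [set F | face F /\
     exists a av k, real_roots (a, av) /\ support F = wall a k].

Definition closure_filter (F : filt AA) : filt AA :=
  [set E | exists E', F E' /\ closure E' `<=` E].

Definition sum_filter (F : filt AA) (Fv : set AA) : filt AA :=
  [set E | exists E', F E' /\ [set x + v | x in E' & v in Fv] `<=` E].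

Definition translate_filter (F : filt AA) (u : AA) : filt AA :=
  [set E | exists E', F E' /\ translate u E' `<=` E].

Definition chimney (F : filt AA) (Fv : set AA) : filt AA :=
  encl (sum_filter F Fv).

Definition solid (F : filt AA) : Prop :=
  finite_set [set w | weyl w /\ forall v, direction (support F) v -> v *m w = v].

Definition chimney_germ (F : filt AA) (Fv : set AA) : filt AA :=
  [set E | exists u, closure Fv u /\ chimney (translate_filter F u) Fv E].

Definition segment (x y : AA) : set AA :=
  [set x + t *: (y - x) | t in [set t : R | 0 <= t <= 1]].

Definition segment_germ (x y : AA) : filt AA :=
  [set E | exists Om, nbhs x Om /\ segment x y `&` Om `<=` E].

Definition ray (x y : AA) : set AA :=
  [set x + t *: (y - x) | t in [set t : R | 0 <= t]].

Definition solid_chimney : set (filt AA) :=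
  [set r | exists F Fv, [/\ face F, vface Fv, r = chimney F Fv & solid r]].

Definition solid_chimney_germ : set (filt AA) :=
  [set r | exists F Fv, [/\ face F, vface Fv, solid (chimney F Fv)
                          & r = chimney_germ F Fv]].

Definition splayed_chimney_germ : set (filt AA) :=
  [set r | exists F Fv, [/\ face F, vface Fv, spherical Fv
                          & r = chimney_germ F Fv]].

(* The filters which are the subject of (MA2). *)
Definition MA2_filter : set (filt AA) :=
  [set F |
   [\/ exists x, F = principal [set x],
       exists x y, [/\ x != y, tits_cone (y - x) \/ tits_cone (x - y)
                             & F = segment_germ x y],
       exists x y, [/\ x != y, generic_cone (y - x) & F = principal (ray x y)]
     | solid_chimney F]].

Definition is_norm (N : AA -> R) : Prop :=
  [/\ forall x y, N (x + y) <= N x + N y,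
      forall t x, N (t *: x) = `|t| * N x
    & forall x, N x = 0 -> x = 0].

End ModelApartment.

Section Filters.
Variables S T : Type.

(* Transport of filters along a chart f : S -> T. *)
Definition push (f : S -> T) (F : set (set S)) : set (set T) :=
  [set E | F (f @^-1` E)].
Definition pull (f : S -> T) (F : set (set T)) : set (set S) :=
  [set E | F (f @` E)].

Definition filter_cup (F F' : set (set T)) : set (set T) :=
  [set G | exists E E', [/\ F E, F' E' & G = E `|` E']].

(* phi, a map defined on A, fixes the filter F. *)
Definition fixes (A : set T) (phi : T -> T) (F : set (set T)) : Prop :=
  F [set x | A x /\ phi x = x].

End Filters.

(* Two distances dE, dF given as functions on the ambient set. *)
Definition lipschitz_map (R : realType) (T T' : Type) (E : set T)
    (dE : T -> T -> R) (dF : T' -> T' -> R) (f : T -> T') : Prop :=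
  exists k : R, 0 <= k /\
    forall x y, E x -> E y -> dF (f x) (f y) <= k * dE x y.

Section Apartments.
Variables (R : realType) (I : finType) (n : nat) (D : root_datum I n).
Variable P : Type.

Local Notation AA := 'rV[R]_n.

(* A family of subsets of P, each with a set of charts: [chart A] is
   Isom^w(AA, A) when A is an apartment. *)
Record apartment_system := ApartmentSystem {
  apt : set (set P);
  chart : set P -> set (AA -> P)
}.

Variable M : apartment_system.

Definition apartment_structure (A : set P) : Prop :=
  exists f0 : AA -> P, [/\ injective f0, range f0 = A
    & chart M A = [set f0 \o a | a in affine_weyl D]].

(* phi : A -> A' read in charts lies in H.  Only the restriction of phi to A
   matters. *)
Definition iso_mod (H : set (AA -> AA)) (A A' : set P) (phi : P -> P) : Prop :=
  forall f f', chart M A f -> chart M A' f' ->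
    exists a, H a /\ phi \o f = f' \o a.

Definition weyl_iso := iso_mod (affine_weyl D).
Definition apt_iso := iso_mod (vweyl_aut D).

(* The isomorphisms AA -> A (vectorially Weyl). *)
Definition model_iso (A : set P) : set (AA -> P) :=
  [set psi | exists f a, [/\ chart M A f, vweyl_aut D a & psi = f \o a]].

(* Objects of a given kind in P are those of the apartments; F0 is a set of
   filters on the model apartment. *)
Definition in_apts (F0 : set (set (set AA))) : set (set (set P)) :=
  [set F | exists A f F', [/\ apt M A, chart M A f, F0 F' & F = push f F']].

Definition encl_in (A : set P) (F : set (set P)) : set (set (set P)) :=
  [set F' | exists f, chart M A f /\ F' = push f (encl D (pull f F))].

Definition MA3_filter : set (set (set P)) :=
  in_apts (@face R I n D `|` @solid_chimney_germ R I n D).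

(* The Weyl isomorphisms phi : A -> A' of (MA2) and of (MA4). *)
Definition MA2_iso (A A' : set P) (phi : P -> P) : Prop :=
  exists f F, [/\ chart M A f, MA2_filter D F, push f F A'
    & weyl_iso A A' phi /\ fixes A phi (push f (encl D F))].

Definition MA4_iso (A A' : set P) (phi : P -> P) : Prop :=
  exists f r F,
    [/\ chart M A f, in_apts (@splayed_chimney_germ R I n D) r, MA3_filter F,
        [/\ r A, F A, r A' & F A']
      & weyl_iso A A' phi /\
        fixes A phi (push f (encl D (pull f (filter_cup r F))))].

Record is_masure : Prop := IsMasure {
  masure_cover : \bigcup_(A in apt M) A = setT;
  MA1 : forall A, apt M A -> apartment_structure A;
  MA2 : forall A A' f F, apt M A -> apt M A' -> chart M A f ->
    MA2_filter D F -> push f F A' ->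
    push f (encl D F) (A `&` A') /\
    exists phi, weyl_iso A A' phi /\ fixes A phi (push f (encl D F));
  MA3 : forall r F, in_apts (@splayed_chimney_germ R I n D) r ->
    MA3_filter F -> exists A, [/\ apt M A, r A & F A];
  MA4 : forall A A' f r F, apt M A -> apt M A' -> chart M A f ->
    in_apts (@splayed_chimney_germ R I n D) r -> MA3_filter F ->
    r A -> F A -> r A' -> F A' ->
    exists phi, weyl_iso A A' phi /\
      fixes A phi (push f (encl D (pull f (filter_cup r F))));
  MAO : forall A A' f f' a b a' b', apt M A -> apt M A' ->
    chart M A f -> chart M A' f' -> f a = f' a' -> f b = f' b' ->
    tits_cone D (b - a) -> f @` segment a b = f' @` segment a' b'
}.

(* The chambers C whose closure contains the panel p; a filter is contained in
   another when it has more elements. *)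
Definition dominating_chambers (p : set (set P)) : set (set (set P)) :=
  [set C | exists A f C0, [/\ apt M A, chart M A f, chamber D C0,
     C = push f C0 & push f (closure_filter C0) `<=` p]].

Definition finite_thick : Prop :=
  forall p, in_apts (@panel R I n D) p ->
    exists m : nat, (2 < m)%N /\ (dominating_chambers p #= `I_m)%card.

Definition is_action (G : groupType) (act : G -> P -> P) : Prop :=
  (forall x, act 1%g x = x) /\
  (forall g h x, act (g * h)%g x = act g (act h x)).

Definition strongly_transitive (G : groupType) (act : G -> P -> P) : Prop :=
  [/\ forall g A, apt M A -> apt M (act g @` A),
      forall g A, apt M A -> apt_iso A (act g @` A) (act g)
    & forall A A' phi, apt M A -> apt M A' ->
        MA2_iso A A' phi \/ MA4_iso A A' phi ->
        exists g, forall x, A x -> act g x = phi x].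

(* The group induced on the model apartment by the stabilizer of A, read in
   the chart f. *)
Definition induced_group (G : groupType) (act : G -> P -> P)
    (A : set P) (f : AA -> P) : set (AA -> AA) :=
  [set a : AA -> AA | exists g, act g @` A = A /\ act g \o f = f \o a].

Definition sector_germ (eps : bool) : set (set (set P)) :=
  in_apts [set s | exists x Cv, vchamber D eps Cv /\ s = germ_infty x Cv].

Definition signed_infty (eps : bool) : set (set AA) :=
  germ_infty 0 [set sgn R eps *: v | v in @Cvf R I n D].

(* rho is the retraction onto the apartment A centered at s. *)
Definition is_retraction (A : set P) (s : set (set P)) (rho : P -> P) : Prop :=
  [/\ apt M A, s A
    & forall x, exists Ax phi, [/\ apt M Ax, Ax x, s Ax
        & [/\ apt_iso Ax A phi, fixes Ax phi s & rho x = phi x]]].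

(* y = x +_s u, for s of sign eps. *)
Definition germ_translate (eps : bool) (s : set (set P)) (x : P) (u : AA)
    (y : P) : Prop :=
  exists A psi b, [/\ apt M A, A x, s A
    & [/\ model_iso A psi, push psi (signed_infty eps) = s,
          psi b = x & y = psi (b + sgn R eps *: u)]].

Definition Uset (eps : bool) (s : set (set P)) (x x' : P) : set (AA * AA) :=
  [set p | [/\ closure (@Cvf R I n D) p.1, closure (@Cvf R I n D) p.2
    & exists y, germ_translate eps s x p.1 y /\ germ_translate eps s x' p.2 y]].

(* d_theta for theta = (N, s), s of sign eps. *)
Definition dtheta (eps : bool) (N : AA -> R) (s : set (set P)) (x x' : P) : R :=
  inf [set N p.1 + N p.2 | p in Uset eps s x x'].

(* d is, on the apartment A, a distance induced by a norm. *)
Definition norm_distance (A : set P) (d : P -> P -> R) : Prop :=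
  exists f N, [/\ chart M A f, is_norm N
    & forall a b, d (f a) (f b) = N (a - b)].

End Apartments.

(* Main.v *)
(* Let [h x] be the position of [x] seen from [s]: its coordinates in an apartment
   containing [x] and [s], for charts that all agree on a subsector of [s].  Then
   [rho] is [h] followed by a chart of [A], so it suffices to bound [h] on every
   apartment containing the other sector-germ [t] (for the second assertion, a
   sector-germ of [B]), uniformly in that apartment.

   Along a segment directed by the chamber of [t], the germ of the segment at
   each of its points lies with [s] in a common apartment, where [h] is affine,
   with linear part in the Weyl group.  Replacing [s] by the successive chambers
   at infinity of a gallery from [t] to [s] multiplies this linear part by [1] or
   by one simple reflection at each step.  Hence only finitely many linear parts
   occur, depending on [s] and [t] alone, and the local bounds integrate to a
   Lipschitz bound along the segment; every displacement is a difference of two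
   vectors of the chamber. *)

Require Import Defs.
From HB Require Import structures.
From mathcomp Require Import all_boot all_order all_algebra.
From mathcomp Require Import ring lra zify.
From mathcomp Require Import all_classical all_reals all_analysis.

Set Implicit Arguments.
Unset Strict Implicit.
Unset Printing Implicit Defensive.

Import Order.TTheory GRing.Theory Num.Theory.
Import numFieldNormedType.Exports.

Local Open Scope classical_set_scope.
Local Open Scope ring_scope.

(** * The Weyl group *)

Section WeylGroup.
Variables (R : realType) (I : finType) (n : nat) (D : root_datum I n).

Local Notation AA := 'rV[R]_n.
Local Notation al := (srootR R D).
Local Notation av := (scorootR R D).
Local Notation refl := (reflection R D).
Local Notation c i j := ((cartan D i j)%:~R : R).

(** The difficulty is uniformity. The number of apartments met along a segment is not controlled,
    and [W^v] may be infinite, so nothing bounds the linear parts a priori. The gallery is therefore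
    taken inside one apartment containing germs of both [s] and [t]: it is fixed before the segment
    is chosen. Crossing a panel at infinity costs at most one reflection because the two linear
    parts differ by an element of [W^v] fixing the panel direction pointwise. That such an element
    is [1] or [r_i] comes from the positivity of roots, hence the opening on words in the
    reflections. (MA3) and (MA4) speak of chimneys, defined through [Delta]. Finding an enclosed
    chimney inside a given sector would require the simple roots to lie in [Delta], a statement
    about the presented Lie algebra; charts on a sector are rebuilt instead from (MA2) along rays.
    Likewise a segment germ is replaced by the chimney germ of a chamber, whose sets contain initial
    pieces of all segments directed by that chamber. *)

Lemma pairingDl (x y : AA) a : pairing (x + y) a = pairing x a + pairing y a.
Proof. by rewrite /pairing mulmxDl mxE. Qed.

Lemma pairingZl k (x : AA) a : pairing (k *: x) a = k * pairing x a.
Proof. by rewrite /pairing -scalemxAl mxE. Qed.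

Lemma pairingNl (x : AA) a : pairing (- x) a = - pairing x a.
Proof. by rewrite -scaleN1r pairingZl mulN1r. Qed.

Lemma pairingBl (x y : AA) a : pairing (x - y) a = pairing x a - pairing y a.
Proof. by rewrite pairingDl pairingNl. Qed.

Lemma pairingZr k (x : AA) a : pairing x (k *: a) = k * pairing x a.
Proof. by rewrite /pairing -scalemxAr mxE. Qed.

Lemma pairing_mulmx (x : AA) (w : 'M[R]_n) a :
  pairing (x *m w) a = pairing x (w *m a).
Proof. by rewrite /pairing mulmxA. Qed.

Lemma coroot_root i j : av i *m al j = (c i j)%:M.
Proof.
rewrite /scorootR /srootR -map_mxM [LHS]mx11_scalar mxE.
by rewrite -(pairing_cartan D i j).
Qed.

Lemma pairing_coroot i j : pairing (av i) (al j) = c i j.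
Proof. by rewrite /pairing coroot_root mxE eqxx mulr1n. Qed.

Lemma cartanii i : c i i = 2.
Proof. by rewrite cartan_diag. Qed.

Lemma cartan_le0R i j : i != j -> c i j <= 0.
Proof. by move=> /(cartan_le0 D); rewrite -(ler_int R). Qed.

Lemma mul_root_coroot m k i j :
  (m : 'cV[R]_n) *m av i *m al j *m (k : 'rV_n) = c i j *: (m *m k).
Proof.
by rewrite -(mulmxA m) coroot_root mul_mx_scalar -scalemxAl.
Qed.

Lemma refl_root i j : refl i *m al j = al j - c i j *: al i.
Proof.
by rewrite /reflection mulmxBl mul1mx -mulmxA coroot_root mul_mx_scalar.
Qed.

Lemma refl_rootii i : refl i *m al i = - al i.
Proof. by rewrite refl_root cartanii scaler_nat mulr2n opprD addrA subrr add0r. Qed.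

Lemma mulmx_refl (x : AA) i : x *m refl i = x - pairing x (al i) *: av i.
Proof.
rewrite /reflection mulmxBr mulmx1 mulmxA.
by rewrite [X in X *m _]mx11_scalar mul_scalar_mx.
Qed.

Lemma pairing_refl (x : AA) i j :
  pairing (x *m refl i) (al j) = pairing x (al j) - c i j * pairing x (al i).
Proof. by rewrite mulmx_refl pairingBl pairingZl pairing_coroot mulrC. Qed.

Lemma reflK i : refl i *m refl i = 1%:M.
Proof.
rewrite {2}/reflection mulmxBr mulmx1 mulmxA refl_rootii mulNmx opprK.
by rewrite /reflection subrK.
Qed.

Lemma refl_unit i : refl i \in unitmx.
Proof. by case/mulmx1_unit: (reflK i). Qed.

Lemma weyl_refl i : weyl D (refl i).
Proof. by rewrite -[refl i]mul1mx; apply: weylM; apply: weyl1. Qed.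

Lemma weyl_mul (v w : 'M[R]_n) : weyl D v -> weyl D w -> weyl D (v *m w).
Proof.
move=> hv; elim=> [|i w' _ IH]; first by rewrite mulmx1.
by rewrite mulmxA; apply: weylM.
Qed.

Lemma weyl_unit (w : 'M[R]_n) : weyl D w -> w \in unitmx.
Proof.
elim=> [|i w' _ IH]; first exact: unitmx1.
by rewrite unitmx_mul IH refl_unit.
Qed.

Lemma weyl_inv (w : 'M[R]_n) : weyl D w -> weyl D (invmx w).
Proof.
elim=> [|i w' hw IH]; first by rewrite invmx1; apply: weyl1.
have -> : invmx (w' *m refl i) = refl i *m invmx w'.
  apply: (can_inj (mulKmx (weyl_unit (weylM i hw)))).
  rewrite mulmxV ?(weyl_unit (weylM i hw)) //.
  by rewrite -mulmxA (mulmxA (refl i)) reflK mul1mx mulmxV // weyl_unit.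
by apply: weyl_mul => //; apply: weyl_refl.
Qed.

(* The head of the list is the last letter of the word. *)
Fixpoint word (s : seq I) : 'M[R]_n :=
  if s is i :: s' then word s' *m refl i else 1%:M.

Lemma word_cat s t : word (s ++ t) = word t *m word s.
Proof. by elim: s => [|i s IH] /=; rewrite ?mulmx1 // IH mulmxA. Qed.

Lemma word_weyl s : weyl D (word s).
Proof. by elim: s => [|i s IH] /=; [apply: weyl1|apply: weylM]. Qed.

Lemma weyl_word (w : 'M[R]_n) : weyl D w -> exists s, w = word s.
Proof. by elim=> [|i w' _ [s ->]]; [exists [::]|exists (i :: s)]. Qed.

(** * Rank-two subgroups: words in two letters *)

Fixpoint alternating k (i j : I) : seq I :=
  if k is k'.+1 then i :: alternating k' j i else [::].

Lemma size_alternating k i j : size (alternating k i j) = k.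
Proof. by elim: k i j => //= k IH i j; rewrite IH. Qed.

Lemma alternating_add k l i j :
  alternating (k + l) i j =
  alternating k i j ++ alternating l (if odd k then j else i)
                                     (if odd k then i else j).
Proof. by elim: k i j => //= k IH i j; rewrite IH; case: (odd k). Qed.

Lemma two_letter_word i j s : all (mem [:: i; j]) s ->
  (exists s', [/\ (size s' < size s)%N, all (mem [:: i; j]) s'
                & word s' = word s]) \/
  s = alternating (size s) i j \/ s = alternating (size s) j i.
Proof.
elim: s => [_|x s IH /= /andP[hx hs]]; first by right; left.
case: (IH hs) => [[s' [h1 h2 h3]]|hs'].
  by left; exists (x :: s') => /=; rewrite h3 hx.
have cancel y z s1 : s = alternating (size s) y z -> x = y ->
    s1 = behead s -> (0 < size s)%N -> word s1 = word (x :: s).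
  case: s {IH hs hs'} => // u s /= [-> _] -> -> _.
  by rewrite -mulmxA reflK mulmx1.
case: (posnP (size s)) => [/size0nil-> /=|s_gt0].
  by move: hx; rewrite !inE => /orP[/eqP->|/eqP->]; right; [left|right].
have hb : all (mem [:: i; j]) (behead s) by case: (s) hs => //= ? ? /andP[].
have sb : (size (behead s) < (size s).+1)%N by rewrite size_behead; lia.
move: hx; rewrite !inE => /orP[]/eqP xE; case: hs' => hs'.
- by left; exists (behead s); split=> //; apply: cancel hs' _ _ _.
- by right; left; rewrite xE /= -hs'.
- by right; right; rewrite xE /= -hs'.
- by left; exists (behead s); split=> //; apply: cancel hs' _ _ _.
Qed.

(* The coordinates of [word s - 1] on the products of [al i], [al j] and
   [av i], [av j]; the letter [true] stands for [i]. *)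
Fixpoint dihedral (cij cji : int) (s : seq bool) : int * int * int * int :=
  if s is b :: s' then
    let: (x, y, z, u) := dihedral cij cji s' in
    if b then (x - (1 + 2 * x + y * cji), y, z - (2 * z + u * cji), u)
    else (x, y - (cij * x + 2 * y), z, u - (1 + z * cij + 2 * u))
  else (0, 0, 0, 0).

Lemma word_dihedral i j s :
  let: (x, y, z, u) := dihedral (cartan D i j) (cartan D j i) s in
  word [seq if b then i else j | b <- s] =
  1%:M + x%:~R *: (al i *m av i) + y%:~R *: (al i *m av j)
       + z%:~R *: (al j *m av i) + u%:~R *: (al j *m av j).
Proof.
elim: s => [|b s] /=; first by rewrite !scale0r !addr0.
case: dihedral => [[[x y] z] u] ->.
case: b; rewrite /reflection mulmxBr mulmx1 !mulmxDl mul1mx -!scalemxAl.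
- rewrite !(mulmxA _ (al i)) !mul_root_coroot !cartanii.
  by rewrite !(intrB, intrD, intrM); apply/matrixP => r t; rewrite !mxE; ring.
- rewrite !(mulmxA _ (al j)) !mul_root_coroot !cartanii.
  by rewrite !(intrB, intrD, intrM); apply/matrixP => r t; rewrite !mxE; ring.
Qed.

Definition in_cone2 i j (v : 'cV[R]_n) :=
  exists x y : R, [/\ 0 <= x, 0 <= y & v = x *: al i + y *: al j].

Lemma word_dihedral_root i j s :
  let: (x, y, z, u) := dihedral (cartan D i j) (cartan D j i) s in
  word [seq if b then i else j | b <- s] *m al i =
  (1 + 2 * x + y * cartan D j i)%:~R *: al i
  + (2 * z + u * cartan D j i)%:~R *: al j.
Proof.
have := word_dihedral i j s.
case: dihedral => [[[x y] z] u] ->.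
rewrite !mulmxDl mul1mx -!scalemxAl -!mulmxA !coroot_root !mul_mx_scalar.
rewrite !cartanii !(intrD, intrM).
by apply/matrixP => r t; rewrite !mxE; ring.
Qed.

Fixpoint balt k (b : bool) : seq bool :=
  if k is k'.+1 then b :: balt k' (~~ b) else [::].

Lemma alternating_balt k i j :
  alternating k i j = [seq if b then i else j | b <- balt k true] /\
  alternating k j i = [seq if b then i else j | b <- balt k false].
Proof. by elim: k => //= k [-> ->]. Qed.

(** The last inequality says that [av i] is nonnegative on [x *: al i + y *: al j]. When
    [c i j * c j i >= 4], reflecting by [j] produces the same condition for [av j] and keeps the new
    coefficient nonnegative, so the induction alternates the two letters. *)
Lemma alternating_cone_infinite i j k (x y : R) : i != j -> 4 <= c i j * c j i ->
  0 <= x -> 0 <= y -> - c i j * y <= 2 * x ->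
  in_cone2 i j (word (alternating k j i) *m (x *: al i + y *: al j)).
Proof.
elim: k i j x y => [|k IH] i j x y ij h4 x0 y0 hxy /=.
  by exists x, y; rewrite mul1mx.
have hi := cartan_le0R ij.
have hj : c j i <= 0 by apply: cartan_le0R; rewrite eq_sym.
rewrite -mulmxA mulmxDr -!scalemxAr refl_root refl_rootii.
have -> : x *: (al i - c j i *: al j) + y *: - al j
          = (- c j i * x - y) *: al j + x *: al i.
  by apply/matrixP => r t; rewrite !mxE; ring.
have hkey : 2 * (- c j i * x - y) >= - c j i * x by nra.
have [|||||x' [y' [x'0 y'0 ->]]] := IH j i (- c j i * x - y) x.
- by rewrite eq_sym.
- by rewrite mulrC.
- by nra.
- by [].
- by [].
by exists y', x'; rewrite addrC.
Qed.

(** The sign and zero conditions leave six pairs of Cartan integers, with Coxeter exponents 2, 3, 4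
    and 6. In each of them the braid relation and the positivity of the shorter words are closed
    integer computations with [dihedral]. *)
Lemma braid_order i j : i != j -> c i j * c j i < 4 ->
  exists m, [/\ (0 < m)%N, word (alternating m j i) = word (alternating m i j)
    & forall k, (k < m)%N -> in_cone2 i j (word (alternating k j i) *m al i)].
Proof.
move=> ij; rewrite -intrM (ltr_int R _ 4) => h4.
have hi := cartan_le0 D ij.
have hj : cartan D j i <= 0 by apply: cartan_le0; rewrite eq_sym.
have h0 := cartan_eq0 D i j.
suff [m [m0 hb hp]] : exists m, [/\ (0 < m)%N,
    dihedral (cartan D i j) (cartan D j i) (balt m false) =
    dihedral (cartan D i j) (cartan D j i) (balt m true)
  & forall k, (k < m)%N ->
     let: (x, y, z, u) :=
       dihedral (cartan D i j) (cartan D j i) (balt k false) in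
     (0 <= 1 + 2 * x + y * cartan D j i) && (0 <= 2 * z + u * cartan D j i)].
  exists m; split=> //.
    have [-> ->] := alternating_balt m i j.
    have := word_dihedral i j (balt m true).
    have := word_dihedral i j (balt m false).
    by rewrite hb; case: dihedral => [[[x y] z] u] -> ->.
  move=> k /hp; have [_ ->] := alternating_balt k i j.
  have := word_dihedral_root i j (balt k false).
  case: dihedral => [[[x y] z] u] -> /andP[h1 h2].
  exists (1 + 2 * x + y * cartan D j i)%:~R, (2 * z + u * cartan D j i)%:~R.
  by split=> //; rewrite ler0z.
have : [|| (cartan D i j == 0) && (cartan D j i == 0),
  (cartan D i j == -1) && (cartan D j i == -1),
  (cartan D i j == -1) && (cartan D j i == -2),
  (cartan D i j == -2) && (cartan D j i == -1),
  (cartan D i j == -1) && (cartan D j i == -3)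
  | (cartan D i j == -3) && (cartan D j i == -1)].
  have [i0|i0] := eqVneq (cartan D i j) 0.
    by rewrite (h0.1 i0).
  have j0 : cartan D j i != 0 by apply: contra i0 => /eqP /h0.2/eqP.
  move: (cartan D i j) (cartan D j i) i0 j0 hi hj h4 {h0} => x y i0 j0 hi hj h4.
  have hx : -3 <= x by nia.
  have hy : -3 <= y by nia.
  have xE : x = -1 \/ x = -2 \/ x = -3 by lia.
  have yE : y = -1 \/ y = -2 \/ y = -3 by lia.
  by case: xE h4 => [|[|]] ->; case: yE => [|[|]] ->.
case/or4P=> [|||/or3P[]] /andP[/eqP-> /eqP->].
- by exists 2%N; split=> //; do 2![case=> //].
- by exists 3%N; split=> //; do 3![case=> //].
- by exists 4%N; split=> //; do 4![case=> //].
- by exists 4%N; split=> //; do 4![case=> //].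
- by exists 6%N; split=> //; do 6![case=> //].
- by exists 6%N; split=> //; do 6![case=> //].
Qed.

Lemma two_letter_cone i j s : i != j -> all (mem [:: i; j]) s ->
  in_cone2 i j (word s *m al i) \/
  exists s', [/\ (size s' < size s)%N, all (mem [:: i; j]) s'
               & word s = word (i :: s')].
Proof.
move=> ij; move: {2}(size s).+1 (ltnSn (size s)) => N.
elim: N s => // N IH s; rewrite ltnS => sN hs.
case: (two_letter_word hs) => [[s1 [h1 h2 h3]]|].
  case: (IH s1 (leq_trans h1 sN) h2); rewrite h3; first by left.
  by case=> s2 [h4 h5 h6]; right; exists s2; split=> //; apply: ltn_trans h1.
have hal k x y : x \in [:: i; j] -> y \in [:: i; j] ->
    all (mem [:: i; j]) (alternating k x y).
  by elim: k x y => //= k IHk x y hx hy; rewrite hx IHk.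
have ii : i \in [:: i; j] by rewrite !inE eqxx.
have jj : j \in [:: i; j] by rewrite !inE eqxx orbT.
case=> sE.
  case: (posnP (size s)) => [/size0nil ->|s0].
    left; exists 1, 0; rewrite mul1mx scale1r scale0r addr0.
    by split=> //; apply: ler01.
  right; rewrite sE -(prednK s0) /=; exists (alternating (size s).-1 j i).
  by rewrite size_alternating; split=> //; apply: hal.
have [h4|h4] := leP 4 (c i j * c j i).
  left; rewrite sE -[al i]scale1r -[1 *: _]addr0 -(scale0r (al j)).
  by apply: alternating_cone_infinite => //; rewrite ?mulr0 ?mulr1 ?ler01 ?ler0n.
have [m [m0 hb hp]] := braid_order ij h4.
have [sm|sm] := ltnP (size s) m; first by left; rewrite sE; apply: hp.
(* The first [m] letters form an alternating word with head [j]; the braid relation turns it into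
   the one with head [i]. *)
right; rewrite sE -(subnKC sm) alternating_add word_cat hb -word_cat.
rewrite -(prednK m0) /=; set t := alternating (size s - _) _ _.
exists (alternating m.-1 j i ++ t).
rewrite /= !size_cat /= !size_alternating; split=> //.
by rewrite all_cat hal //= /t; case: ifP => _; apply: hal.
Qed.

(** * Positivity of roots and simple transitivity on chambers *)

Definition in_cone (v : 'cV[R]_n) :=
  exists2 z : I -> R, (forall i, 0 <= z i) & v = \sum_i z i *: al i.

Lemma in_coneD x y v v' : 0 <= x -> 0 <= y -> in_cone v -> in_cone v' ->
  in_cone (x *: v + y *: v').
Proof.
move=> x0 y0 [z z0 ->] [z' z'0 ->]; exists (fun i => x * z i + y * z' i).
  by move=> i; rewrite addr_ge0 // mulr_ge0.
rewrite !scaler_sumr -big_split; apply: eq_bigr => i _.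
by rewrite /= !scalerA scalerDl.
Qed.

Lemma root_in_cone i : in_cone (al i).
Proof.
exists (fun j => (j == i)%:R) => [j|]; first by rewrite ler0n.
rewrite (bigD1 i) //= eqxx scale1r big1 ?addr0 // => j /negPf->.
by rewrite scale0r.
Qed.

(* Tits' argument: factor the word as [v d] with [d] in the dihedral group of
   the last letter and [i], and [v] as short as possible. *)
Lemma word_root s i :
  in_cone (word s *m al i) \/
  exists2 s', (size s' < size s)%N & word s = word (i :: s').
Proof.
move: {2}(size s).+1 (ltnSn (size s)) => N.
elim: N s i => // N IH s i; rewrite ltnS => sN.
case: s sN => [_|t s sN]; first by left; rewrite mul1mx; apply: root_in_cone.
have [<-|ti] := eqVneq t i; first by right; exists s.
pose P l := `[< exists d v, [/\ all (mem [:: i; t]) d, size v = l,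
  (size d + size v <= (size s).+1)%N & word (t :: s) = word (d ++ v)] >].
have exP : exists l, P l.
  by exists (size s); apply/asboolP; exists [:: t], s; rewrite /= !inE eqxx orbT.
case: (ex_minnP exP) => l /asboolP[d [v [hd vl dv hw]]] lmin.
have ls : (l <= size s)%N.
  by apply: lmin; apply/asboolP; exists [:: t], s; rewrite /= !inE eqxx orbT.
have vN : (size v < N)%N by rewrite vl (leq_ltn_trans ls).
(* Otherwise the induction hypothesis rewrites [v] as a shorter word preceded by [j]; moving that
   letter into [d] contradicts the minimality of [l]. *)
have vpos j : j \in [:: i; t] -> in_cone (word v *m al j).
  move=> hj; case: (IH v j vN) => // -[v' hv' vE].
  suff : (l <= size v')%N by rewrite leqNgt -vl hv'.
  apply: lmin; apply/asboolP; exists (d ++ [:: j]), v'; split=> //.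
  - by rewrite all_cat hd /= andbT.
  - by rewrite size_cat addn1 addSnnS (leq_trans _ dv) // leq_add2l.
  - by rewrite hw -catA cat1s !word_cat vE.
have it : i != t by rewrite eq_sym.
case: (two_letter_cone it hd) => [[x [y [x0 y0 dE]]]|[d' [hd' d'a dE]]].
  left; rewrite hw word_cat -mulmxA dE mulmxDr -!scalemxAr.
  by apply: in_coneD => //; apply: vpos; rewrite !inE eqxx ?orbT.
right; exists (d' ++ v).
  by rewrite size_cat (leq_trans _ dv) // ltn_add2r.
by rewrite hw word_cat dE -cat_cons word_cat.
Qed.

Lemma root_neq0 i : al i != 0.
Proof.
apply/eqP => ai; have := pairing_coroot i i.
by rewrite ai /pairing mulmx0 mxE cartanii => /eqP; rewrite eq_sym pnatr_eq0.
Qed.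

(** In a shortest word [i :: s] for [w], minimality makes [word s *m al i] a nonnegative combination
    of simple roots. The point [x] is positive on each of them, while [x *m w] in the closed chamber
    forces the value on the combination to be at most 0; the combination would then vanish, which an
    invertible matrix forbids. *)
Lemma weyl_chamber_simple (w : 'M[R]_n) (x : AA) : weyl D w -> Cvf D x ->
  (forall i, 0 <= pairing (x *m w) (al i)) -> w = 1%:M.
Proof.
move=> /weyl_word ww xC xw.
pose P l := `[< exists2 s, size s = l & w = word s >].
have exP : exists l, P l by case: ww => s ws; exists (size s); apply/asboolP; exists s.
case: (ex_minnP exP) => l /asboolP[s sl ws] lmin.
case: s => [//|i s] in sl ws *; exfalso.
case: (word_root s i) => [[z z0 zE]|[s' s's sE]]; last first.
  suff : (l <= size s')%N by rewrite leqNgt -sl /= (ltn_trans s's).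
  apply: lmin; apply/asboolP; exists s' => //.
  by rewrite ws /= sE /= -mulmxA reflK mulmx1.
have := xw i; rewrite pairing_mulmx ws /= -mulmxA refl_rootii mulmxN zE.
rewrite -scaleN1r pairingZr mulN1r oppr_ge0 /pairing mulmx_sumr summxE.
under eq_bigr do rewrite -scalemxAr mxE -/(pairing _ _).
move=> sum_le0.
have sum0 : forall j, z j * pairing x (al j) = 0.
  move=> j; apply/eqP; rewrite eq_le; apply/andP; split; last first.
    by rewrite mulr_ge0 // ltW.
  apply: le_trans sum_le0; rewrite (bigD1 j) //= lerDl sumr_ge0 // => k _.
  by rewrite mulr_ge0 // ltW.
have : word s *m al i = 0.
  rewrite zE big1 // => j _; have /eqP := sum0 j.
  by rewrite mulf_eq0 (gt_eqF (xC j)) orbF => /eqP ->; rewrite scale0r.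
move=> /(congr1 (mulmx (invmx (word s)))).
rewrite mulKmx ?mulmx0 ?weyl_unit //; last exact: word_weyl.
by apply/eqP; apply: root_neq0.
Qed.

End WeylGroup.

(** * Norms on the model apartment *)

Section Norms.
Variables (R : realType) (n : nat).
Implicit Types (N p : 'rV[R]_n -> R) (x y v : 'rV[R]_n) (a : 'cV[R]_n).

(** Covers the norms, the functions [|a(x)|] and the [N (x *m w)] at once, so that a single
    comparison with a norm serves them all. *)
Definition seminorm p := (forall x y, p (x + y) <= p x + p y) /\
  (forall t x, p (t *: x) = `|t| * p x).

Lemma is_norm_seminorm N : is_norm N -> seminorm N.
Proof. by case. Qed.

Lemma seminorm0 p : seminorm p -> p 0 = 0.
Proof. by case=> _ h; rewrite -(scale0r 0) h normr0 mul0r. Qed.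

Lemma seminormN p x : seminorm p -> p (- x) = p x.
Proof. by case=> _ h; rewrite -scaleN1r h normrN1 mul1r. Qed.

Lemma seminorm_ge0 p x : seminorm p -> 0 <= p x.
Proof.
move=> hp; have := hp.1 x (- x); rewrite subrr (seminorm0 hp) (seminormN _ hp).
by rewrite -mulr2n pmulrn_lge0.
Qed.

Lemma seminorm_sum p (J : finType) (F : J -> 'rV[R]_n) : seminorm p ->
  p (\sum_j F j) <= \sum_j p (F j).
Proof.
move=> hp; elim/big_ind2: _ => //; first by rewrite (seminorm0 hp).
by move=> u s v t hu hv; apply: le_trans (hp.1 _ _) (lerD hu hv).
Qed.

Lemma seminorm_pairing a : seminorm (fun x => `|pairing x a|).
Proof.
by split=> [x y|t x]; rewrite ?pairingDl ?ler_normD // pairingZl normrM.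
Qed.

Lemma seminorm_mulmx N (w : 'M[R]_n) : seminorm N -> seminorm (fun x => N (x *m w)).
Proof. by move=> [h1 h2]; split=> [x y|t x]; rewrite ?mulmxDl -?scalemxAl. Qed.

Lemma entry_le_norm x j : `|x 0 j| <= `|x|.
Proof.
by rewrite [leRHS]/Num.norm /= mx_normrE; apply/bigmax_geP; right; exists (0, j).
Qed.

Lemma seminorm_le_mx_norm p : seminorm p ->
  exists2 K, 0 <= K & forall x, p x <= K * `|x|.
Proof.
move=> hp; exists (\sum_j p (delta_mx 0 j)).
  by apply: sumr_ge0 => j _; apply: seminorm_ge0.
move=> x; rewrite {1}[x]row_sum_delta mulr_suml.
apply: le_trans (seminorm_sum _ hp) _; apply: ler_sum => j _.
by rewrite hp.2 mulrC ler_wpM2l ?seminorm_ge0 ?entry_le_norm.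
Qed.

Lemma mx_norm_le_is_norm N : is_norm N ->
  exists2 K, 0 <= K & forall x, `|x| <= K * N x.
Proof.
move=> hN; have hp := is_norm_seminorm hN.
have [K K0 hK] := seminorm_le_mx_norm hp.
pose S : set 'rV[R]_n := [set x | `|x| = 1].
have scaleS x : x != 0 -> S (`|x|^-1 *: x).
  by move=> x0; rewrite /S /= normrZ normfV normr_id mulVf // normr_eq0.
(* The unit sphere is empty when 0 is the only vector; any constant does then. Otherwise compactness
   gives a minimum of [N] on it, positive because [N] separates points. *)
have [S0|/set0P/negP/negPn/eqP S0] := pselect (S !=set0); last first.
  exists 0 => // x; have [->|/scaleS] := eqVneq x 0; first by rewrite normr0 mul0r.
  by rewrite S0.
have Ncont_at (x : 'rV[R]_n) (B : set R) :
    nbhs (N x : R^o) B -> nbhs x [set y | B (N y)].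
  move=> /nbhs_normP[e /= e0 he].
  have hxy z t : N z - N t <= N (z - t).
    by rewrite lerBlDr -{1}[z](subrK t); apply: hp.1.
  apply/(nbhs_normP x); exists (e / (K + 1)) => [/=|y /= h].
    by rewrite divr_gt0 // ltr_wpDl.
  apply: he => /=; apply: (@le_lt_trans _ _ (N (x - y))).
    by rewrite ler_norml hxy andbT lerNl opprB -(seminormN (x - y)) // opprB hxy.
  move: h; rewrite ltr_pdivlMr ?ltr_wpDl // => h.
  apply: le_lt_trans (hK _) _; apply: le_lt_trans h.
  by rewrite mulrC ler_wpM2l // lerDl.
have Ncont : continuous N by move=> x B; exact: Ncont_at.
have Scomp : compact S.
  apply: bounded_closed_compact.
    by exists 1; split; [exact: num_real | move=> r r1 x /= ->; exact: ltW].
  rewrite (_ : S = (@Num.norm R 'rV[R]_n) @^-1` [set 1]); last by [].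
  by apply: closed_comp => [x _|]; [apply: norm_continuous | exact: closed_eq].
have [m Sm hm] := EVT_min_rV S0 Scomp (continuous_subspaceT Ncont).
have Nm : 0 < N m.
  rewrite lt_neqAle (seminorm_ge0 _ hp) andbT eq_sym; apply/eqP.
  case: hN => _ _ /[apply] m0.
  by move: Sm; rewrite m0 inE /S /= normr0 => /eqP; rewrite eq_sym oner_eq0.
exists (N m)^-1; first by rewrite invr_ge0 ltW.
move=> x; have [->|x0] := eqVneq x 0.
  by rewrite normr0 mulr_ge0 // ?invr_ge0 ?seminorm_ge0 // ltW.
have := hm (`|x|^-1 *: x); rewrite inE => /(_ (scaleS _ x0)).
rewrite hp.2 normfV normr_id => h.
by rewrite ler_pdivlMl // mulrC -ler_pdivlMl ?normr_gt0.
Qed.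

Lemma seminorm_le_is_norm p N : seminorm p -> is_norm N ->
  exists2 K, 0 <= K & forall x, p x <= K * N x.
Proof.
move=> /seminorm_le_mx_norm[K K0 hK] /mx_norm_le_is_norm[K' K'0 hK'].
exists (K * K') => [|x]; first exact: mulr_ge0.
by rewrite (le_trans (hK x)) // -mulrA ler_wpM2l.
Qed.

Lemma nbhs_plane (p : 'rV[R]_n) (O : set 'rV[R]_n) v v' : nbhs p O ->
  exists2 d, 0 < d & forall s t, `|s| <= d -> `|t| <= d -> O (p + s *: v + t *: v').
Proof.
move=> /nbhs_normP[e /= e0 he].
have K0 : 0 < `|v| + `|v'| + 1 by rewrite ltr_wpDl // addr_ge0.
exists (e / (`|v| + `|v'| + 1)); first by rewrite divr_gt0.
move=> s t hs ht; apply: he; rewrite /= -addrA opprD addNKr normrN.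
apply: le_lt_trans (ler_normD _ _) _; rewrite !normrZ.
apply: (@le_lt_trans _ _ (e / (`|v| + `|v'| + 1) * (`|v| + `|v'|))).
  by rewrite mulrDr lerD // ler_wpM2r.
by rewrite mulrAC ltr_pdivrMr // ltr_pM2l // ltrDl.
Qed.

Lemma nbhs_line (p : 'rV[R]_n) (O : set 'rV[R]_n) v : nbhs p O ->
  exists2 d, 0 < d & forall s, `|s| <= d -> O (p + s *: v).
Proof.
move=> /(nbhs_plane v 0)[d d0 hd]; exists d => // s hs.
by have := hd s 0 hs; rewrite normr0 scale0r addr0; apply; apply: ltW.
Qed.

Lemma nbhs_pairing x a (k : R) : k < pairing x a ->
  nbhs x [set y | k < pairing y a].
Proof.
move=> xa; have [K K0 hK] := seminorm_le_mx_norm (seminorm_pairing a).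
have K1 : 0 < K + 1 by rewrite ltr_wpDl.
apply/(nbhs_normP x); exists ((pairing x a - k) / (K + 1)) => /=.
  by rewrite divr_gt0 ?subr_gt0.
move=> y /=; rewrite ltr_pdivlMr // => h.
suff : pairing x a - pairing y a < pairing x a - k by rewrite ltrD2l ltrN2.
rewrite -pairingBl; apply: le_lt_trans (ler_norm _) _.
apply: le_lt_trans (hK _) _; apply: le_lt_trans h.
by rewrite mulrC ler_wpM2l // lerDl.
Qed.

Lemma closure_pairing_ge0 (S : set 'rV[R]_n) x a : closure S x ->
  (forall y, S y -> 0 <= pairing y a) -> 0 <= pairing x a.
Proof.
move=> xS h; rewrite leNgt; apply/negP => xa.
have xa' : 0 < pairing x (- a).
  by rewrite -scaleN1r pairingZr mulN1r oppr_gt0.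
have [y [/h ya]] := xS _ (nbhs_pairing xa').
by rewrite /= -scaleN1r pairingZr mulN1r oppr_gt0 ltNge ya.
Qed.

Lemma closure_line (S : set 'rV[R]_n) x v :
  (forall t, 0 < t <= 1 -> S (x + t *: v)) -> closure S x.
Proof.
move=> h B /(nbhs_line v)[d d0 hd]; exists (x + Num.min d 1 *: v); split.
  by apply: h; rewrite lt_min d0 ltr01 ge_min lexx orbT.
by apply: hd; rewrite ger0_norm ?ge_min ?lexx // le_min ler01 ltW.
Qed.

Lemma nbhs_mulmx x (w : 'M[R]_n) (O : set 'rV[R]_n) :
  nbhs (x *m w) O -> nbhs x [set y | O (y *m w)].
Proof.
have hp : seminorm (@Num.norm R 'rV[R]_n).
  by split=> [u v|t u]; [exact: ler_normD | exact: normrZ].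
have [K K0 hK] := seminorm_le_mx_norm (seminorm_mulmx w hp).
have K1 : 0 < K + 1 by rewrite ltr_wpDl.
move=> /nbhs_normP[e /= e0 he]; apply/(nbhs_normP x); exists (e / (K + 1)) => /=.
  by rewrite divr_gt0.
move=> y /=; rewrite ltr_pdivlMr // => h.
apply: he; rewrite /= -mulmxBl; apply: le_lt_trans (hK _) _.
by apply: le_lt_trans h; rewrite mulrC ler_wpM2l // lerDl.
Qed.

End Norms.

(** * Chambers and the affine Weyl group *)

Section Chambers.
Variables (R : realType) (I : finType) (n : nat) (D : root_datum I n).

Local Notation AA := 'rV[R]_n.
Local Notation al := (srootR R D).
Local Notation refl := (reflection R D).

Lemma rat_row_int m (v : 'rV[rat]_m) :
  exists (d : int) (z : 'I_m -> int), d != 0 /\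
    forall j, d%:~R * v 0 j = (z j)%:~R.
Proof.
exists (\prod_j denq (v 0 j)),
  (fun j => numq (v 0 j) * \prod_(k < m | k != j) denq (v 0 k)).
split; first by rewrite prodf_seq_neq0; apply/allP => j _; rewrite denq_neq0.
move=> j; rewrite (bigD1 j) //= !intrM mulrAC; congr (_ * _).
by rewrite mulrC -{1}[v 0 j]divq_num_den mulfVK // intr_eq0 denq_neq0.
Qed.

(** [sroot_free] is independence over the integers only. Clearing denominators makes it independence
    over the rationals, and a right inverse of the rational matrix of simple roots remains one over
    [R]. *)
Lemma fundamental_coweights : exists om : I -> AA,
  forall i j, pairing (om i) (al j) = (i == j)%:R.
Proof.
pose S : 'M[rat]_(#|I|, n) := \matrix_(k, j) (sroot D (enum_val k) j 0)%:~R.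
have /row_freeP[T ST] : row_free S.
  apply: inj_row_free => v vS0.
  have [d [z [d0 hz]]] := rat_row_int v.
  have zfree : \sum_i z (enum_rank i) *: sroot D i = 0.
    apply/matrixP => j k; rewrite ord1 !mxE summxE.
    apply: (@intr_inj rat); rewrite rmorph_sum /=.
    have := congr1 (fun u : 'rV_n => d%:~R * u 0 j) vS0.
    rewrite /mulmx !mxE mulr0 mulr_sumr => vSj.
    rewrite -[RHS]/0 -[RHS]vSj.
    rewrite (reindex (@enum_val I I)) /=; last first.
      by exists enum_rank => i _; rewrite ?enum_valK ?enum_rankK.
    apply: eq_bigr => i _; rewrite mxE intrM enum_valK -hz.
    by rewrite mulrA [S _ _]mxE.
  apply/rowP => k; rewrite mxE; have := sroot_free zfree (enum_val k).
  rewrite enum_valK => zk; have := hz k; rewrite zk => /eqP.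
  by rewrite mulf_eq0 intr_eq0 (negPf d0) => /eqP.
exists (fun i => \row_j ratr (T j (enum_rank i))) => i j.
have := congr1 (fun A : 'M[rat]_#|I| => ratr (A (enum_rank j) (enum_rank i)) : R) ST.
rewrite /pairing !mxE rmorph_sum /= => sumE.
rewrite eq_sym -(inj_eq (@enum_rank_inj I)) -(ratr_nat R) -sumE.
apply: eq_bigr => k _; rewrite !mxE enum_rankK rmorphM /= ratr_int mulrC.
by [].
Qed.

Definition coweight : I -> AA := sval (cid fundamental_coweights).

Lemma pairing_coweight i j : pairing (coweight i) (al j) = (i == j)%:R.
Proof. exact: (svalP (cid fundamental_coweights)). Qed.

(** A base point of the face [F^v(J)]: the simple roots outside [J] take the value 1 there. For
    empty [J] it serves throughout as the direction in which to go deep into a sector. *)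
Definition face_vector (J : {set I}) : AA := \sum_(i in ~: J) coweight i.

Lemma pairing_sum (J : finType) (A : pred J) (F : J -> AA) a :
  pairing (\sum_(i | A i) F i) a = \sum_(i | A i) pairing (F i) a.
Proof. by rewrite /pairing mulmx_suml summxE. Qed.

Lemma pairing_face_vector J i : pairing (face_vector J) (al i) = (i \notin J)%:R.
Proof.
rewrite pairing_sum; under eq_bigr do rewrite pairing_coweight.
have [iJ|iJ] := boolP (i \in J); last first.
  by rewrite (bigD1 i) ?inE //= eqxx big1 ?addr0 // => j /andP[_ /negPf->].
by rewrite big1 // => j; rewrite inE; case: eqVneq iJ => // -> ->.
Qed.

Lemma std_face0 : std_face D finset.set0 = @Cvf R I n D.
Proof.
apply/funext => v; apply/propext; split=> h i; have := h i; rewrite ?inE //.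
Qed.

Lemma std_face_vector J : std_face D J (face_vector J).
Proof.
by move=> i; rewrite pairing_face_vector; case: (i \in J) => /=; rewrite ?ltr01.
Qed.

Lemma std_face_scale J t v : 0 < t -> std_face D J v -> std_face D J (t *: v : AA).
Proof.
move=> t0 h i; have := h i; rewrite pairingZl.
by case: ifP => _ => [->|]; [rewrite mulr0 | apply: mulr_gt0].
Qed.

Lemma std_face_add J u v : std_face D J u -> std_face D J v ->
  std_face D J (u + v : AA).
Proof.
move=> hu hv i; have := hu i; have := hv i; rewrite pairingDl.
by case: ifP => _ => [-> ->|? ?]; [rewrite addr0 | apply: addr_gt0].
Qed.

Lemma closure_std_face J u : closure (std_face D J) u ->
  forall i, (i \in J -> pairing u (al i) = 0) /\ 0 <= pairing (u : AA) (al i).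
Proof.
move=> uJ i; have u0 : 0 <= pairing u (al i).
  by apply: closure_pairing_ge0 uJ _ => y /(_ i); case: ifP => _ => [->|/ltW].
split=> // iJ; apply/eqP; rewrite eq_le u0 andbT -oppr_ge0.
rewrite -mulN1r -pairingZr scaleN1r.
apply: closure_pairing_ge0 uJ _ => y /(_ i); rewrite iJ.
by rewrite -scaleN1r pairingZr mulN1r => ->; rewrite oppr0.
Qed.

Lemma closure_std_face_add J u v : closure (std_face D J) u ->
  std_face D J v -> std_face D J (u + v : AA).
Proof.
move=> /closure_std_face hu hv i; have [h1 h2] := hu i; have := hv i.
rewrite pairingDl; case: ifP => [/h1->|_]; first by rewrite add0r.
exact: ltr_wpDl.
Qed.

Lemma closure_std_face0 J : closure (std_face D J) (0 : AA).
Proof.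
apply: (@closure_line _ _ _ _ (face_vector J)) => t /andP[t0 _].
by rewrite add0r; apply: std_face_scale => //; apply: std_face_vector.
Qed.

Lemma closure_Cvf u :
  closure (@Cvf R I n D) u <-> forall i, 0 <= pairing u (al i).
Proof.
split=> [|h]; first by rewrite -std_face0 => /closure_std_face h i; case: (h i).
apply: (@closure_line _ _ _ _ (face_vector finset.set0)) => t /andP[t0 _] i.
by rewrite pairingDl pairingZl pairing_face_vector inE mulr1 ltr_wpDl.
Qed.

Lemma Cvf_face_vector : Cvf D (face_vector finset.set0).
Proof. by rewrite -std_face0; apply: std_face_vector. Qed.

Lemma Cvf_add_ge0 u v : (forall i, 0 <= pairing u (al i)) -> Cvf D v ->
  Cvf D (u + v : AA).
Proof. by move=> hu hv i; rewrite pairingDl ltr_wpDl. Qed.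

Lemma Cvf_add u v : Cvf D u -> Cvf D v -> Cvf D (u + v : AA).
Proof. by move=> hu; apply: Cvf_add_ge0 => i; apply: ltW. Qed.

Lemma Cvf_scale t v : 0 < t -> Cvf D v -> Cvf D (t *: v : AA).
Proof. by rewrite -std_face0; apply: std_face_scale. Qed.

Lemma le_sum_finite (b : I -> R) i : (forall j, 0 <= b j) -> b i <= \sum_j b j.
Proof. by move=> b0; rewrite (bigD1 i) //= lerDl sumr_ge0. Qed.

Lemma Cvf_deep (x v : AA) : Cvf D v ->
  exists2 l, 0 < l & forall t, l <= t -> Cvf D (x + t *: v).
Proof.
move=> vC; pose b i := `|pairing x (al i)| / pairing v (al i).
have b0 i : 0 <= b i by rewrite divr_ge0 // ltW.
have s0 : 0 < \sum_i b i + 1 by rewrite ltr_wpDl ?sumr_ge0.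
exists (\sum_i b i + 1) => // t ht i.
rewrite pairingDl pairingZl -[X in X + _]opprK addrC subr_gt0.
apply: le_lt_trans (ler_norm _) _; rewrite normrN -ltr_pdivrMr // -/(b i).
by apply: le_lt_trans (le_sum_finite i b0) _; rewrite (lt_le_trans _ ht) // ltrDl.
Qed.

Lemma nbhs_Cvf x : Cvf D x -> nbhs (x : AA) (@Cvf R I n D).
Proof.
move=> xC; have := @filter_forall _ I (fun i => [set y | 0 < pairing y (al i)])
  (nbhs x) _; apply; move=> i; exact: nbhs_pairing.
Qed.

Lemma Cvf_tits x : (forall i, 0 <= pairing x (al i)) -> tits_cone D (x : AA).
Proof.
move=> xC; exists x, 1%:M; split; [exact/closure_Cvf | exact: weyl1 |].
by rewrite mulmx1.
Qed.

Lemma tits_weyl x w : weyl D w -> tits_cone D (x : AA) -> tits_cone D (x *m w).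
Proof.
move=> hw [v [w' [vC hw' ->]]]; exists v, (w' *m w); split=> //.
  exact: weyl_mul.
by rewrite mulmxA.
Qed.

Lemma generic_Cvf x : Cvf D x -> generic_cone D (x : AA).
Proof.
move=> xC; left; apply: filterS (nbhs_Cvf xC) => y yC.
by apply: Cvf_tits => i; apply: ltW.
Qed.

(** Near a point of the panel only [alpha_i] can change sign, so every nearby point lies in the
    closed chamber or in its image under [r_i]. Panel directions are thus spherical, as (MA3) and
    (MA4) require. *)
Lemma generic_panel i x : std_face D (finset.set1 i) x -> generic_cone D (x : AA).
Proof.
move=> xF; left.
have near_pos w : x *m w = x ->
    nbhs x [set y : AA | forall j, j != i -> 0 < pairing (y *m w) (al j)].
  move=> xw; have := @filter_forall _ I
    (fun j => [set y : AA | j != i -> 0 < pairing (y *m w) (al j)]) (nbhs x) _.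
  apply=> j; have [->|ji] := eqVneq j i; first exact: filterS filterT.
  have := xF j; rewrite inE (negPf ji) -{1}xw pairing_mulmx => /nbhs_pairing h.
  by apply: filterS h => y /= + _; rewrite pairing_mulmx.
have xi : x *m refl i = x.
  by have := xF i; rewrite inE eqxx mulmx_refl => ->; rewrite scale0r subr0.
apply: filterS (filterI (near_pos _ (mulmx1 x)) (near_pos _ xi)) => y [hy hyi].
have [yi|yi] := lerP 0 (pairing y (al i)).
  apply: Cvf_tits => j; have [->//|ji] := eqVneq j i.
  by have := hy j ji; rewrite mulmx1 => /ltW.
rewrite -[y]mulmx1 -(reflK R D i) mulmxA; apply: tits_weyl; first exact: weyl_refl.
apply: Cvf_tits => j; have [->|ji] := eqVneq j i; last exact/ltW/hyi.
by rewrite pairing_refl cartanii; lra.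
Qed.

Lemma generic_weyl x w : weyl D w -> generic_cone D (x : AA) ->
  generic_cone D (x *m w).
Proof.
move=> hw [] hx; [left|right].
- have : nbhs (x *m w *m invmx w) (tits_cone D) by rewrite mulmxK ?(weyl_unit hw).
  move/nbhs_mulmx => h1; apply: filterS h1 => y /(tits_weyl hw).
  by rewrite mulmxKV ?(weyl_unit hw).
- have : nbhs (- (x *m w) *m invmx w) (tits_cone D).
    by rewrite mulNmx mulmxK ?(weyl_unit hw).
  move/nbhs_mulmx => h1; apply: filterS h1 => y /(tits_weyl hw).
  by rewrite mulmxKV ?(weyl_unit hw).
Qed.

(** Push the panel point [xi] slightly into the chamber along [et]. According to the sign of
    [alpha_i] on [et *m w], either [w] or [w *m refl i] keeps the pushed point in the closed
    chamber, hence is the identity. *)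
Lemma weyl_fix_panel i w : weyl D w ->
  (forall v : AA, std_face D (finset.set1 i) v -> v *m w = v) -> w = 1%:M \/ w = refl i.
Proof.
move=> hw hfix; set xi := face_vector (finset.set1 i); set et := coweight i.
have xiw : xi *m w = xi by apply/hfix/std_face_vector.
have key w' : weyl D w' -> xi *m w' = xi -> 0 <= pairing (et *m w') (al i) ->
    w' = 1%:M.
  move=> hw' fix' h0.
  have s0 : 0 < 1 + \sum_j `|pairing (et *m w') (al j)|.
    by rewrite ltr_pwDl // sumr_ge0.
  (* Small enough that, for [j != i], the value 1 of [alpha_j] at [xi] outweighs its value on
     [t *: (et *m w')]. *)
  set t := (1 + \sum_j `|pairing (et *m w') (al j)|)^-1.
  have t0 : 0 < t by rewrite invr_gt0.
  apply: (@weyl_chamber_simple _ _ _ D _ (xi + t *: et)) => //.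
    move=> j; rewrite pairingDl pairingZl pairing_coweight pairing_face_vector.
    by rewrite inE eq_sym; case: eqVneq => _ /=; rewrite ?mulr1 ?mulr0 ?addr0 ?add0r.
  move=> j; rewrite mulmxDl fix' -scalemxAl pairingDl pairingZl.
  rewrite pairing_face_vector inE; have [->|ji] /= := eqVneq j i.
    by rewrite add0r mulr_ge0 // ltW.
  suff : `|t * pairing (et *m w') (al j)| <= 1.
    by rewrite ler_norml => /andP[h _]; rewrite -lerBlDl sub0r.
  rewrite normrM gtr0_norm // /t ler_pdivrMl // mulr1.
  pose b k := `|pairing (et *m w') (al k)|.
  have b0 k : 0 <= b k by exact: normr_ge0.
  by apply: le_trans (le_sum_finite j b0) _; rewrite lerDr ler01.
have [h0|h0] := lerP 0 (pairing (et *m w) (al i)); first by left; apply: key.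
right; suff : w *m refl i = 1%:M.
  by move=> /(congr1 (mulmx^~ (refl i))); rewrite -mulmxA reflK mulmx1 mul1mx.
apply: key; first exact: weylM.
  rewrite mulmxA xiw mulmx_refl pairing_face_vector inE eqxx scale0r subr0 //.
by rewrite mulmxA pairing_refl cartanii; lra.
Qed.

Lemma weyl_fix_vector w x : weyl D w -> Cvf D (x : AA) -> x *m w = x -> w = 1%:M.
Proof.
by move=> hw xC xw; apply: (weyl_chamber_simple hw xC) => i; rewrite xw; apply/ltW/xC.
Qed.

Lemma weyl_closed_chamber w : weyl D w ->
  (forall v : AA, Cvf D v -> forall i, 0 <= pairing (v *m w) (al i)) -> w = 1%:M.
Proof.
move=> hw h; apply: (weyl_chamber_simple hw Cvf_face_vector).
exact/h/Cvf_face_vector.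
Qed.

(** * The affine Weyl group *)

Lemma affmap_comp (w w' : 'M[R]_n) t t' :
  affmap w t \o affmap w' t' = affmap (w' *m w) (t' *m w + t).
Proof. by apply/funext => x; rewrite /affmap /= mulmxDl mulmxA addrA. Qed.

Lemma affmap1 : affmap (1%:M : 'M[R]_n) 0 = id.
Proof. by apply/funext => x; rewrite /affmap mulmx1 addr0. Qed.

Lemma coroot_latticeD t t' : coroot_lattice D t -> coroot_lattice D t' ->
  coroot_lattice D (t + t' : AA).
Proof.
move=> [z ->] [z' ->]; exists (fun i => z i + z' i).
by rewrite -map_mxD -big_split; congr map_mx; apply: eq_bigr => i _; rewrite scalerDl.
Qed.

Lemma coroot_latticeN t : coroot_lattice D t -> coroot_lattice D (- t : AA).
Proof.
move=> [z ->]; exists (fun i => - z i).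
by rewrite -map_mxN -sumrN; congr map_mx; apply: eq_bigr => i _; rewrite scaleNr.
Qed.

Lemma coroot_lattice0 : coroot_lattice D (0 : AA).
Proof.
by exists (fun=> 0); rewrite big1 ?map_mx0 // => i _; rewrite scale0r.
Qed.

Lemma coroot_lattice_weyl t w : weyl D w -> coroot_lattice D t ->
  coroot_lattice D (t *m w : AA).
Proof.
move=> hw; elim: hw t => [|i w' _ IH] t ht; first by rewrite mulmx1.
rewrite mulmxA mulmx_refl; apply: coroot_latticeD; first exact: IH.
apply: coroot_latticeN; have [z ->] := IH t ht.
pose m := \sum_k z k * cartan D k i.
exists (fun j => if j == i then m else 0).
have -> : \sum_j (if j == i then m else 0) *: scoroot D j = m *: scoroot D i.
  rewrite (bigD1 i) //= eqxx big1 ?addr0 // => j /negPf->.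
  by rewrite scale0r.
rewrite /scorootR; apply/rowP => k; rewrite !mxE intrM; congr (_ * _).
rewrite /pairing /srootR -map_mxM mxE mulmx_suml summxE; congr _%:~R.
by apply: eq_bigr => j _; rewrite -scalemxAl mxE pairing_cartan.
Qed.

Lemma affine_weyl_comp a b : affine_weyl D a -> affine_weyl D b ->
  affine_weyl D (a \o b : AA -> AA).
Proof.
move=> [w [t [hw ht ->]]] [w' [t' [hw' ht' ->]]].
exists (w' *m w), (t' *m w + t); rewrite affmap_comp; split=> //.
  exact: weyl_mul.
by apply: coroot_latticeD => //; apply: coroot_lattice_weyl.
Qed.

Lemma affine_weyl_linear w : weyl D w -> affine_weyl D (affmap w (0 : AA)).
Proof. by move=> hw; exists w, 0; split=> //; apply: coroot_lattice0. Qed.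

Lemma affine_weyl_inv a : affine_weyl D a -> exists2 b : AA -> AA,
  affine_weyl D b & (a \o b = id /\ b \o a = id).
Proof.
move=> [w [t [hw ht ->]]]; have wu := weyl_unit hw.
exists (affmap (invmx w) (- t *m invmx w)).
  exists (invmx w), (- t *m invmx w); split=> //; first exact: weyl_inv.
  by apply: coroot_lattice_weyl; [exact: weyl_inv | exact: coroot_latticeN].
split; rewrite affmap_comp.
  by rewrite mulVmx // mulmxKV // addNr affmap1.
by rewrite mulmxV // mulNmx subrr affmap1.
Qed.

End Chambers.

(** * Filters on the model apartment *)

Section ModelFilters.
Variables (R : realType) (I : finType) (n : nat) (D : root_datum I n).

Local Notation AA := 'rV[R]_n.

(** An affine form bounded below on a ray has nonnegative slope, so the direction of a ray contained
    in an intersection of half-spaces may be added to any of its points. *)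
Lemma root_inter_cone k (x v y : AA) :
  (forall t, 0 < t -> root_inter D k (x + t *: v)) ->
  root_inter D k y -> root_inter D k (y + v).
Proof.
move=> hx hy a aD; have := hy a aD; rewrite /halfspace /=.
case E : (k a) => [m|//]; rewrite pairingDl => hya.
suff : 0 <= pairing v (map_mx intr a) by lra.
rewrite leNgt; apply/negP => v0.
set c := pairing x (map_mx intr a) + m%:~R.
have t0 : 0 < (`|c| + 1) / - pairing v (map_mx intr a).
  by rewrite divr_gt0 ?ltr_wpDl // oppr_gt0.
have := hx _ t0 a aD; rewrite /halfspace /= E pairingDl pairingZl addrAC -/c.
rewrite invrN mulrN mulNr divfK ?lt_eqF //.
by have := ler_norm c; lra.
Qed.

Lemma root_inter_closed k (x v : AA) d : 0 < d ->
  (forall t, 0 < t <= d -> root_inter D k (x + t *: v)) -> root_inter D k x.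
Proof.
move=> d0 h a aD; rewrite /halfspace /=; case E : (k a) => [m|//].
rewrite leNgt; apply/negP => x0.
set c := pairing x (map_mx intr a) + m%:~R in x0.
set b := pairing v (map_mx intr a).
pose t := Num.min d (- c / (`|b| + 1) / 2).
have b1 : 0 < `|b| + 1 by rewrite ltr_wpDl.
have t0 : 0 < t by rewrite /t lt_min d0 !divr_gt0 // oppr_gt0.
have := h t; rewrite t0 ge_min lexx => /(_ isT a aD).
rewrite /halfspace /= E pairingDl pairingZl addrAC -/c -/b => h1.
have h2 : t * (`|b| + 1) <= - c / 2.
  by rewrite -ler_pdivlMr // mulrAC ge_min lexx orbT.
have := ler_norm (t * b); rewrite normrM gtr0_norm // => h3.
have : t * `|b| <= t * (`|b| + 1) by rewrite ler_pM2l // lerDl.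
by lra.
Qed.

Lemma face_filter_nbhs (x : AA) Fv E : face_filter D x Fv E ->
  exists2 O, nbhs x O & forall v, Fv v -> O (x + v) -> E (x + v).
Proof.
move=> [k [k' [U [xO kE Ok]]]]; exists U => // v Fvv Ov.
by apply/kE/Ok; split=> //; exists v.
Qed.

Lemma face_filter_root_inter (x : AA) Fv k :
  (forall v, Fv v -> root_inter D k (x + v)) -> face_filter D x Fv (root_inter D k).
Proof.
move=> h; exists k, (fun=> None), setT; split; first exact: filterT.
  by move=> y hy a /hy[].
by move=> y [_ [v Fvv <-]] a aD; split; [exact: h | ].
Qed.

Lemma chimney_germ_elem (y : AA) Dv Fv E :
  chimney_germ D (face_filter D y Dv) Fv E ->
  exists k u O, [/\ closure Fv u, nbhs y O, root_inter D k `<=` E &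
    forall d v, Dv d -> O (y + d) -> Fv v -> root_inter D k (y + d + u + v)].
Proof.
move=> [u [uF [k [kE [E1 [[E2 [hE2 uE2]] E1k]]]]]].
have [U yO hO] := face_filter_nbhs hE2.
exists k, u, U; split=> // d v dD Od vF; apply: E1k; exists (y + d + u).
  by apply: uE2; exists (y + d); [exact: hO | rewrite addrC].
by exists v.
Qed.

Lemma chimney_germ_root_inter (y : AA) (Fv : set AA) k :
  (forall t v, 0 < t -> Fv v -> Fv (t *: v)) -> closure Fv 0 ->
  (forall v, Fv v -> root_inter D k (y + v)) ->
  chimney_germ D (face_filter D y Fv) Fv (root_inter D k).
Proof.
move=> Fscale F0 h; exists 0; split=> //; exists k; split=> //.
exists (root_inter D k); split; last first.
  move=> _ [x hx] [v vF <-]; apply: (root_inter_cone (x := y)) => // t t0.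
  exact/h/Fscale.
exists (root_inter D k); split; first exact: face_filter_root_inter.
by move=> _ [x hx <-]; rewrite add0r.
Qed.

Lemma chimney_germ_total (y : AA) Dv Fv u X : closure Fv u -> (forall z, X z) ->
  chimney_germ D (face_filter D y Dv) Fv X.
Proof.
move=> uF hX; exists u; split=> //; exists (fun=> None); split=> [z _|].
  exact: hX.
exists setT; split=> //; exists setT; split=> //.
by exists (fun=> None), (fun=> None), setT; split=> //; exact: filterT.
Qed.

Definition chamber_set eps (w : 'M[R]_n) : set AA :=
  [set sgn R eps *: (v *m w) | v in @Cvf R I n D].

Lemma sgn_mul eps : sgn R eps * sgn R eps = 1.
Proof. by case: eps; rewrite /sgn ?mulr1 // mulrNN mulr1. Qed.

Lemma chamber_set1 : chamber_set true 1%:M = @Cvf R I n D.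
Proof.
apply/seteqP; split=> [_ [v vC <-]|v vC]; first by rewrite scale1r mulmx1.
by exists v => //; rewrite scale1r mulmx1.
Qed.

Lemma vface_chamber_set eps w : weyl D w -> vface D (chamber_set eps w).
Proof. by move=> hw; exists eps, w, finset.set0; rewrite std_face0. Qed.

Lemma vface_std_face J : vface D (@std_face R I n D J).
Proof.
exists true, 1%:M, J; split; first exact: weyl1.
apply/seteqP; split=> [v vC|_ [v vC <-]]; last by rewrite scale1r mulmx1.
by exists v => //; rewrite scale1r mulmx1.
Qed.

Lemma vface_nonempty Fv : vface D Fv -> exists v : AA, Fv v.
Proof.
move=> [eps [w [J [_ ->]]]]; exists (sgn R eps *: (face_vector R D J *m w)).
by exists (face_vector R D J) => //; apply: std_face_vector.
Qed.

Lemma chamber_set_perturb eps w (d x : AA) t : weyl D w -> chamber_set eps w d ->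
  0 < t -> exists2 s0, 0 < s0 & forall s, 0 < s <= s0 ->
    chamber_set eps w (t *: d + s *: x).
Proof.
move=> hw [v vC <-] t0.
have [l l0 hl] := Cvf_deep (sgn R eps *: (x *m invmx w)) vC.
exists (t / l); first by rewrite divr_gt0.
move=> s /andP[s0 sl]; exists (s *: (sgn R eps *: (x *m invmx w) + (t / s) *: v)).
  by apply: Cvf_scale => //; apply: hl; rewrite ler_pdivlMr // mulrC -ler_pdivlMr.
rewrite -scalemxAl mulmxDl -!scalemxAl mulmxKV ?(weyl_unit hw) //.
rewrite !scalerDr !scalerA addrC; congr (_ *: _ + _ *: _).
  by rewrite -mulrA [s * _]mulrC divfK ?gt_eqF // mulrC.
by rewrite mulrAC sgn_mul mul1r.
Qed.

(** Each set of this filter contains a translate of an open piece of a cone, so no proper affine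
    subspace belongs to it. The direction of its support is the whole space, fixed only by the
    identity. *)
Lemma solid_chamber_chimney (y : AA) eps w Fv : weyl D w -> vface D Fv ->
  solid D (chimney D (face_filter D y (chamber_set eps w)) Fv).
Proof.
move=> hw /vface_nonempty[v0 v0F].
suff full Z : affine_subspace Z ->
    chimney D (face_filter D y (chamber_set eps w)) Fv Z -> Z = setT.
  apply: (@sub_finite_set _ _ [set 1%:M]); last exact: finite_set1.
  move=> w' [_ h]; apply/row_matrixP => i; rewrite !rowE mulmx1; apply: h.
  have sT x : Defs.support (chimney D (face_filter D y (chamber_set eps w)) Fv) x.
    by move=> Z [Za /(full _ Za)->].
  by exists (delta_mx 0 i), 0; rewrite subr0; split.
move=> [x0 [m ->]] [k [kZ [E [/face_filter_nbhs[U yO hO] Ek]]]].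
pose d0 := sgn R eps *: (face_vector R D finset.set0 *m w).
have d0D : chamber_set eps w d0.
  by exists (face_vector R D finset.set0) => //; apply: Cvf_face_vector.
have inZ d : chamber_set eps w d -> U (y + d) -> (y + d + v0 - x0 <= m)%MS.
  move=> dD Od; apply: kZ; apply: Ek; exists (y + d); first exact: hO.
  by exists v0.
have mfull x : ((x : AA) <= m)%MS.
  have [t t0 ht] := nbhs_plane d0 x yO.
  have [s0 s00 hs] := chamber_set_perturb x hw d0D t0.
  pose s := Num.min s0 t.
  have sp : 0 < s by rewrite lt_min s00.
  have sD : chamber_set eps w (t *: d0 + s *: x).
    by apply: hs; rewrite sp ge_min lexx.
  have tD : chamber_set eps w (t *: d0).
    have [v vC dE] := d0D; exists (t *: v); first exact: Cvf_scale.
    by rewrite -scalemxAl scalerA mulrC -scalerA dE.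
  have st : `|s| <= t by rewrite gtr0_norm // ge_min lexx orbT.
  have tt : `|t| <= t by rewrite gtr0_norm.
  have h1 := inZ _ tD; have h2 := inZ _ sD.
  have {}h1 : (y + t *: d0 + v0 - x0 <= m)%MS.
    by apply: h1; have := ht t 0 tt; rewrite normr0 scale0r addr0; apply; apply: ltW.
  have {}h2 : (y + (t *: d0 + s *: x) + v0 - x0 <= m)%MS.
    by apply: h2; rewrite addrA; apply: ht.
  have : (s *: x <= m)%MS.
    have -> : s *: x = (y + (t *: d0 + s *: x) + v0 - x0)
                      - (y + t *: d0 + v0 - x0).
      by apply/rowP => j; rewrite !mxE; ring.
    by apply: addmx_sub => //; rewrite eqmx_opp.
  by rewrite eqmx_scale ?gt_eqF.
by apply/seteqP; split=> // x _ /=; apply: mfull.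
Qed.

(* A chimney germ in the trivial direction: unlike those of the face at [p], its
   elements contain the point [p] itself. *)
Definition segment_face (p : AA) eps : set (set AA) :=
  chimney_germ D (face_filter D p (chamber_set eps 1%:M)) (std_face D finset.setT).

(** The translation [u] hidden in the germ can be undone since [F^v(I)] is a linear subspace and
    contains [- u]. The end point [t = 0], which the open chamber misses, is recovered because the
    half-spaces are closed. *)
Lemma segment_face_elem p eps v E : Cvf D v -> segment_face p eps E ->
  exists2 d, 0 < d & forall t, 0 <= t <= d -> E (p + t *: (sgn R eps *: v)).
Proof.
move=> vC /chimney_germ_elem[k [u [U [uF pU kE hk]]]].
have [d d0 hd] := nbhs_line (sgn R eps *: v) pU.
have h t : 0 < t <= d -> root_inter D k (p + t *: (sgn R eps *: v)).
  move=> /andP[t0 td].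
  have -> : p + t *: (sgn R eps *: v) = p + t *: (sgn R eps *: v) + u + - u.
    by rewrite addrK.
  apply: hk; last 2 first.
  - by apply: hd; rewrite gtr0_norm.
  - move=> i; rewrite finset.inE pairingNl.
    by have [/(_ (finset.in_setT i))-> _] := closure_std_face uF i; rewrite oppr0.
  exists (t *: v); first exact: Cvf_scale.
  by rewrite mulmx1 !scalerA mulrC.
exists d => // t /andP[t0 td]; apply: kE.
have [->|tn0] := eqVneq t 0; last by apply: h; rewrite lt_neqAle eq_sym tn0 t0.
by rewrite scale0r addr0; apply: root_inter_closed d0 h.
Qed.

End ModelFilters.

(** * Charts and sector-germs *)

Section Charts.
Variables (R : realType) (I : finType) (n : nat) (D : root_datum I n).
Variables (P : Type) (M : apartment_system R n P) (hM : is_masure D M).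

Local Notation AA := 'rV[R]_n.
Implicit Types (A : set P) (f : AA -> P).

Lemma apt_chart A : apt M A -> exists f, chart M A f.
Proof.
move=> /(MA1 hM)[f0 [_ _ ->]]; exists (f0 \o affmap 1%:M 0), (affmap 1%:M 0) => //.
by apply: affine_weyl_linear; apply: weyl1.
Qed.

Lemma chart_inj A f : apt M A -> chart M A f -> injective f.
Proof.
move=> /(MA1 hM)[f0 [f0i _ ->]] [a /affine_weyl_inv[b _ [_ ba]] <-].
apply: inj_comp => //; apply: (@can_inj _ _ _ b) => x.
by rewrite -[LHS]/((b \o a) x) ba.
Qed.

Lemma chart_in A f x : apt M A -> chart M A f -> A (f x).
Proof. by move=> /(MA1 hM)[f0 [_ <- ->]] [a _ <-]; exists (a x). Qed.

Lemma chart_surj A f p : apt M A -> chart M A f -> A p -> exists x, f x = p.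
Proof.
move=> /(MA1 hM)[f0 [_ <- ->]] [a /affine_weyl_inv[b _ [ab _]] <-] [x _ <-].
by exists (b x); rewrite /= -[a (b x)]/((a \o b) x) ab.
Qed.

Lemma chart_comp A f a : apt M A -> chart M A f -> affine_weyl D a ->
  chart M A (f \o a).
Proof.
move=> /(MA1 hM)[f0 [_ _ ->]] [b hb <-] ha; exists (b \o a) => //.
exact: affine_weyl_comp.
Qed.

Lemma chart_trans A f f' : apt M A -> chart M A f -> chart M A f' ->
  exists2 a, affine_weyl D a & f' = f \o a.
Proof.
move=> /(MA1 hM)[f0 [_ _ ->]] [a ha <-] [b hb <-].
have [a' ha' [aa' _]] := affine_weyl_inv ha.
exists (a' \o b); first exact: affine_weyl_comp.
by rewrite -compA [a \o _]compA aa'.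
Qed.

Lemma weyl_iso_chart A A' f phi : apt M A' -> chart M A f ->
  weyl_iso D M A A' phi -> chart M A' (phi \o f).
Proof.
move=> hA' hf hphi; have [f' hf'] := apt_chart hA'.
by have [a [ha ->]] := hphi f f' hf hf'; apply: chart_comp.
Qed.

Lemma ray_chart A A' f x v : apt M A -> apt M A' -> chart M A f ->
  generic_cone D v -> (forall t, 0 <= t -> A' (f (x + t *: v))) ->
  exists2 e, chart M A' e & forall t, 0 <= t -> e (x + t *: v) = f (x + t *: v).
Proof.
move=> hA hA' hf vgen hray.
suff [phi [hphi [k [hk hx]]]] : exists phi, weyl_iso D M A A' phi /\
    exists k, root_inter D k `<=` [set z | phi (f z) = f z] /\
              forall t, 0 <= t -> root_inter D k (x + t *: v).
  exists (phi \o f); first exact: weyl_iso_chart hphi.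
  by move=> t t0; apply/hk/hx.
(* The zero vector is generic when the Tits cone is a neighbourhood of it; the ray is then a point,
   also allowed in (MA2). *)
have [v0|v0] := eqVneq v 0.
  have hF : MA2_filter D (principal [set x]) by constructor 1; exists x.
  have [|_ [phi [hphi [k [kf kx]]]]] := MA2 hM hA hA' hf hF.
    by move=> _ ->; have := hray 0 (lexx 0); rewrite scale0r addr0.
  exists phi; split=> //; exists k; split=> [z /kf[]//|t _].
  by rewrite v0 scaler0 addr0; apply: kx.
have hF : MA2_filter D (principal (ray x (x + v))).
  constructor 3; exists x, (x + v); split=> //; last by rewrite addrC addKr.
  by rewrite eq_sym -subr_eq0 addrC addKr.
have [|_ [phi [hphi [k [kf kx]]]]] := MA2 hM hA hA' hf hF.
  by move=> _ [t /= t0 <-]; rewrite [x + v]addrC addrK; apply: hray.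
exists phi; split=> //; exists k; split=> [z /kf[]//|t t0].
by apply: kx; exists t => //; rewrite [x + v]addrC addrK.
Qed.

(** Finer than equality of sector-germs, which determines a chart of a given apartment only up to
    translation; see [same_germ_charts]. *)
Definition deep_eq f f' := exists y, forall v, Cvf D v -> f (y + v) = f' (y + v).

Lemma deep_eq_sym f f' : deep_eq f f' -> deep_eq f' f.
Proof. by move=> [y h]; exists y => v vC; rewrite h. Qed.

Lemma addr_subA (V : zmodType) (x y v : V) : y + (x - y + v) = x + v.
Proof. by rewrite [x - y]addrC -addrA addNKr. Qed.

Lemma deep_two (y y' : AA) : exists z, Cvf D (z - y) /\ Cvf D (z - y').
Proof.
have [l l0 hl] := Cvf_deep (- y) (Cvf_face_vector R D).
have [l' l'0 hl'] := Cvf_deep (- y') (Cvf_face_vector R D).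
exists (Num.max l l' *: face_vector R D finset.set0).
by rewrite ![_ - _]addrC; split; [apply: hl | apply: hl']; rewrite le_max lexx ?orbT.
Qed.

Lemma deep_eq_trans f f' f'' : deep_eq f f' -> deep_eq f' f'' -> deep_eq f f''.
Proof.
move=> [y h] [y' h']; have [z [zy zy']] := deep_two y y'.
exists z => v vC; rewrite -(addr_subA z y) h ?addr_subA; last exact: Cvf_add.
by rewrite -(addr_subA z y') h' //; apply: Cvf_add.
Qed.

Lemma deep_eq_translate f f' q : deep_eq f f' ->
  deep_eq (fun x => f (x + q)) (fun x => f' (x + q)).
Proof.
move=> [y h]; exists (y - q) => v vC.
have -> : y - q + v + q = y + v by rewrite addrAC subrK.
exact: h.
Qed.

(** This makes coordinates seen from a sector-germ well defined. By (MAO) the ray from the common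
    point into the sector stays in [A']; (MA2) then yields a chart of [A'] equal to [f] on this ray.
    Its transition map to [f'] is affine and fixes the far part of the ray, hence also the
    origin. *)
Lemma deep_eq_point A A' f f' z z' : apt M A -> apt M A' ->
  chart M A f -> chart M A' f' -> deep_eq f f' -> f z = f' z' -> z = z'.
Proof.
move=> hA hA' hf hf' [y hy] zz'; pose v := face_vector R D finset.set0.
have vC : Cvf D v := Cvf_face_vector R D.
have [l l0 hl] := Cvf_deep (z - y) vC.
have deep t : l <= t -> f (z + t *: v) = f' (z + t *: v).
  by move=> /hl/hy; rewrite addr_subA.
have inA' t : 0 <= t -> A' (f (z + t *: v)).
  move=> t0; have tl : 0 < t + l by rewrite ltr_wpDl.
  have tits : tits_cone D (z + (t + l) *: v - z).
    rewrite addrC addKr; apply: Cvf_tits => i; apply/ltW.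
    exact: (Cvf_scale tl vC).
  have seg := MAO hM hA hA' hf hf' zz' (deep (t + l) _) tits.
  have : (f @` segment z (z + (t + l) *: v)) (f (z + t *: v)).
    exists (z + t *: v) => //; exists (t / (t + l)).
      apply/andP; split; first by rewrite divr_ge0 // ltW.
      by rewrite ler_pdivrMr // mul1r lerDl ltW.
    by rewrite addrAC subrr add0r scalerA divfK // gt_eqF.
  rewrite seg; last by rewrite lerDr.
  by move=> [x _ <-]; apply: chart_in hf'.
have [e he ee] := ray_chart hA hA' hf (generic_Cvf vC) inA'.
have [a [w [q [hw _ aE]]] eE] := chart_trans hA' hf' he.
have fixa t : l <= t -> (z + t *: v) *m w + q = z + t *: v.
  move=> lt; apply: (chart_inj hA' hf').
  by rewrite -deep // -ee ?(le_trans (ltW l0)) // eE aE.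
have fixl := fixa l (lexx l); have := fixa (l + 1).
rewrite lerDl ler01 scalerDl scale1r addrA mulmxDl [LHS]addrAC fixl.
move=> /(_ isT)/addrI vw.
have zw : z *m w + q = z.
  move: fixl; rewrite mulmxDl -scalemxAl vw addrAC => /addIr; exact.
apply: (chart_inj hA' hf'); rewrite -zz'.
by have := ee 0 (lexx 0); rewrite scale0r addr0 => <-; rewrite eE aE /= /affmap zw.
Qed.

End Charts.

(** * Charts adapted to a sector-germ *)

Section SectorGerms.
Variables (R : realType) (I : finType) (n : nat) (D : root_datum I n).
Variables (P : Type) (M : apartment_system R n P) (hM : is_masure D M).

Local Notation AA := 'rV[R]_n.
Local Notation al := (srootR R D).
Local Notation rho := (face_vector R D finset.set0).

(* In a chart of [A] that agrees with [f1] along one ray, [f1] is affine along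
   all rays of the sector, hence bi-affine in the plane spanned by two rays; it
   is also affine along the diagonal, which kills the mixed term. *)
Lemma based_chart A1 A f1 y : apt M A1 -> apt M A -> chart M A1 f1 ->
  (forall v, Cvf D v -> A (f1 (y + v))) ->
  exists2 f, chart M A f & deep_eq D f f1.
Proof.
move=> hA1 hA hf1 hy; pose z0 := y + rho; have rhoC := Cvf_face_vector R D.
have hray z v : Cvf D (z - y) -> Cvf D v -> exists2 e, chart M A e &
    forall t, 0 <= t -> e (z + t *: v) = f1 (z + t *: v).
  move=> zC vC; apply: (ray_chart hM hA1 hA hf1 (generic_Cvf vC)).
  move=> t t0; rewrite -(addr_subA z y); apply: hy; rewrite addrC.
  by apply: Cvf_add_ge0 => // i; rewrite pairingZl mulr_ge0 // ltW.
have z0C : Cvf D (z0 - y) by rewrite /z0 addrC addKr.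
have [e0 he0 ee0] := hray z0 rho z0C rhoC.
exists e0 => //; exists z0 => u uC.
have inA z : Cvf D (z - y) -> A (f1 z) by move=> /hy; rewrite addrC subrK.
pose a z := xget z [set x | e0 x = f1 z].
have aP z : Cvf D (z - y) -> e0 (a z) = f1 z.
  move=> /inA /(chart_surj hM hA he0)[x xz].
  have ex : exists x, [set x | e0 x = f1 z] x by exists x.
  exact: (xgetPex z ex).
have aray z v : Cvf D (z - y) -> Cvf D v -> exists2 w, weyl D w &
    forall t, 0 <= t -> a (z + t *: v) = a z + t *: (v *m w).
  move=> zC vC; have [e he ee] := hray z v zC vC.
  have [b [w [q [hw _ bE]]] eE] := chart_trans hM hA he0 he.
  have ab t : 0 <= t -> a (z + t *: v) = b (z + t *: v).
    move=> t0; apply: (chart_inj hM hA he0).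
    rewrite aP; first by rewrite -ee // eE.
    rewrite addrAC addrC; apply: Cvf_add_ge0 => // i.
    by rewrite pairingZl mulr_ge0 // ltW.
  exists w => // t t0; rewrite ab //.
  have := ab 0 (lexx 0); rewrite scale0r addr0 => ->.
  by rewrite bE /affmap mulmxDl -scalemxAl addrAC.
have zsC s : 0 <= s -> Cvf D (z0 + s *: rho - y).
  move=> s0; rewrite addrAC addrC; apply: Cvf_add_ge0 => // i.
  by rewrite pairingZl mulr_ge0 // ltW.
have zuC s : 0 <= s -> Cvf D (z0 + s *: u - y).
  move=> s0; rewrite addrAC addrC; apply: Cvf_add_ge0 => // i.
  by rewrite pairingZl mulr_ge0 // ltW.
have a0 s : 0 <= s -> a (z0 + s *: rho) = z0 + s *: rho.
  by move=> s0; apply: (chart_inj hM hA he0); rewrite aP ?ee0 //; apply: zsC.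
have az0 : a z0 = z0 by have := a0 0 (lexx 0); rewrite scale0r addr0.
have [wu _ hu0] := aray z0 u z0C uC; rewrite az0 in hu0.
have hus s : 0 <= s -> exists g, forall t, 0 <= t ->
    a (z0 + s *: rho + t *: u) = z0 + s *: rho + t *: g.
  move=> s0; have [w _ hw] := aray _ u (zsC s s0) uC.
  by exists (u *m w) => t t0; rewrite hw // a0.
have htr t : 0 <= t -> exists h, forall s, 0 <= s ->
    a (z0 + s *: rho + t *: u) = z0 + t *: (u *m wu) + s *: h.
  move=> t0; have [w _ hw] := aray _ rho (zuC t t0) rhoC.
  by exists (rho *m w) => s s0; rewrite addrAC hw // hu0.
have [h1 hh1] := htr 1 ler01.
have H s t : 0 <= s -> 0 <= t -> a (z0 + s *: rho + t *: u) =
    z0 + s *: rho + t *: (u *m wu + s *: (h1 - rho)).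
  move=> s0 t0; have [g hg] := hus s s0; rewrite hg //.
  congr (_ + _ *: _); have := hg 1 ler01; rewrite hh1 // !scale1r => gE.
  have -> : g = (z0 + s *: rho + g) - (z0 + s *: rho) by rewrite addrC addKr.
  by rewrite -gE; apply/rowP => j; rewrite !mxE; ring.
have rhouC : Cvf D (rho + u) by apply: Cvf_add.
have [wd _ hd] := aray z0 (rho + u) z0C rhouC; rewrite az0 in hd.
have h1rho : h1 = rho.
  have := hd 1 ler01; have := hd 2 (ler0n _ _).
  rewrite !scalerDr !addrA !H ?ler01 ?ler0n // !scale1r => e2 e1.
  apply/rowP => j; have := congr1 (fun v : AA => v 0 j) e1.
  have := congr1 (fun v : AA => v 0 j) e2.
  by rewrite !mxE; lra.
(* For large [l] both [l *: rho + u] and its image [l *: rho + u *m wu] lie in the chamber. One is a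
   Weyl transform of the other, so they coincide and [u *m wu = u]. *)
have [l l0 hl] := Cvf_deep (u *m wu) rhoC.
have luC : Cvf D (l *: rho + u) by apply: Cvf_add => //; apply: Cvf_scale.
have [w hw hwE] := aray z0 (l *: rho + u) z0C luC.
have := hwE 1 ler01; rewrite az0 !scale1r addrA -[u in LHS]scale1r.
rewrite H ?ler01 ?(ltW l0) // h1rho subrr scaler0 addr0 scale1r -addrA.
move=> /addrI wE.
have w1 : w = 1%:M.
  apply: (weyl_chamber_simple hw luC) => i; rewrite -wE addrC; apply/ltW.
  exact: hl.
move: wE; rewrite w1 mulmx1 => /addrI uE.
rewrite -aP; last by rewrite -[u]scale1r; apply: zuC.
by have := hu0 1 ler01; rewrite !scale1r uE => ->.
Qed.

Lemma germ_inftyE x (E : set AA) : germ_infty x (@Cvf R I n D) E <->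
  exists y, forall v, Cvf D v -> E (y + v).
Proof.
split=> [[u [_ uE]]|[y hy]]; first by exists (x + u) => v vC; apply: uE; exists v.
have [l l0 hl] := Cvf_deep (x - y) (Cvf_face_vector R D).
exists (l *: rho); split.
  by apply/closure_Cvf => i; apply/ltW; exact: (Cvf_scale l0 (Cvf_face_vector R D)).
move=> _ [v vC <-]; rewrite -addrA -(addr_subA x y); apply: hy.
by rewrite addrA; apply: Cvf_add => //; apply: hl.
Qed.

Definition chart_germ (f : AA -> P) : set (set P) :=
  push f (germ_infty 0 (@Cvf R I n D)).

Lemma chart_germE f E : chart_germ f E <-> exists y, forall v, Cvf D v -> E (f (y + v)).
Proof. exact: germ_inftyE. Qed.

Lemma deep_eq_germ f f' : deep_eq D f f' -> chart_germ f = chart_germ f'.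
Proof.
suff sub g g' : deep_eq D g g' -> chart_germ g `<=` chart_germ g'.
  by move=> h; apply/seteqP; split; apply: sub => //; apply: deep_eq_sym.
move=> [y h] E /chart_germE[y' h']; apply/chart_germE.
have [z [zy zy']] := deep_two D y y'; exists z => v vC.
rewrite -(addr_subA z y) -h ?addr_subA; last exact: Cvf_add.
by rewrite -(addr_subA z y'); apply: h'; apply: Cvf_add.
Qed.

Lemma sector_germ_chart s : sector_germ D M true s ->
  exists A f, [/\ apt M A, chart M A f & s = chart_germ f].
Proof.
move=> [A [f [_ [hA hf [x [_ [[w [hw ->]] ->]]] ->]]]].
exists A, (f \o affmap w 0); split=> //.
  by apply: (chart_comp hM) => //; apply: affine_weyl_linear.
apply/seteqP; split=> E.
  move=> [u [_ uE]]; apply/chart_germE; exists ((x + u) *m invmx w) => v vC.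
  apply: uE; exists (sgn R true *: (v *m w)); first by exists v.
  by rewrite /affmap addr0 mulmxDl mulmxKV ?(weyl_unit hw) // scale1r.
move=> /chart_germE[y hy].
have [l l0 hl] := Cvf_deep (x *m invmx w - y) (Cvf_face_vector R D).
exists ((l *: rho) *m w); split.
  apply: (@closure_line _ _ _ _ (rho *m w)) => t /andP[t0 _].
  exists (l *: rho + t *: rho); last by rewrite scale1r mulmxDl -!scalemxAl.
  by apply: Cvf_add; apply: Cvf_scale => //; apply: Cvf_face_vector.
move=> _ [_ [v vC <-] <-]; rewrite scale1r.
have -> : x + l *: rho *m w + v *m w =
    affmap w 0 (y + (x *m invmx w - y + l *: rho + v)).
  rewrite /affmap addr0 -[in RHS]addrA addr_subA !mulmxDl mulmxKV ?(weyl_unit hw) //.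
  by rewrite addrA.
by apply: hy; apply: Cvf_add => //; apply: hl.
Qed.

Lemma germ_based_chart A f1 A1 : apt M A1 -> chart M A1 f1 -> apt M A ->
  chart_germ f1 A -> exists2 f, chart M A f & deep_eq D f f1.
Proof. by move=> hA1 hf1 hA /chart_germE[y hy]; apply: (based_chart hA1 hA hf1 hy). Qed.

Lemma same_germ_charts A f f' : apt M A -> chart M A f -> chart M A f' ->
  chart_germ f = chart_germ f' -> exists q, f' = fun x => f (x + q).
Proof.
move=> hA hf hf' ff'; have [_ [w [q [hw _ ->]]] f'E] := chart_trans hM hA hf hf'.
suff w1 : w = 1%:M.
  by exists q; rewrite f'E w1; apply/funext => x; rewrite /affmap /= mulmx1.
have : chart_germ f' (f @` @Cvf R I n D).
  by rewrite -ff'; apply/chart_germE; exists 0 => v vC; exists v; rewrite ?add0r.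
move=> /chart_germE[y hy]; apply: weyl_closed_chamber hw _ => v vC i.
have pos t : 0 < t -> 0 < pairing (y *m w + q) (al i) + t * pairing (v *m w) (al i).
  move=> t0; have [x xC] := hy _ (Cvf_scale t0 vC).
  rewrite f'E => /(chart_inj hM hA hf) xE.
  by have := xC i; rewrite xE /affmap mulmxDl -scalemxAl addrAC pairingDl pairingZl.
rewrite leNgt; apply/negP => vi.
set b := pairing _ _ in vi pos; set c := pairing _ _ in pos.
have t0 : 0 < (`|c| + 1) / - b by rewrite divr_gt0 ?ltr_wpDl // oppr_gt0.
have := pos _ t0; rewrite invrN mulrN mulNr divfK ?lt_eqF //.
by have := ler_norm c; lra.
Qed.

End SectorGerms.

(** * Adjacent sector-germs *)

(** Connectedness of the line stands in for a finite chain of neighbouring parameters, the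
    admissible radius depending on the centre. *)
Lemma locally_constant (R : realType) (T : R -> Prop) :
  (forall c : R, exists2 d : R, 0 < d &
    forall c' : R, `|c' - c| <= d -> (T c <-> T c')) ->
  forall a b, T a -> T b.
Proof.
move=> hT a b Ta.
have op (S : set R) : (forall c, exists2 d, 0 < d &
    forall c', `|c' - c| <= d -> (S c -> S c')) -> open (S : set R^o).
  move=> hS; rewrite openE => c Sc; have [d d0 hd] := hS c.
  apply/(nbhs_normP c); exists d => //= c' /ltW; rewrite distrC => h.
  exact: (hd c' h).
have conn : connected [set: R^o] by apply/connected_intervalP.
pose S : set R^o := [set c | T c].
suff -> : T b = [set: R^o] b by [].
rewrite -[T b]/(S b) (conn S) //; first by exists a.
  exists S; rewrite ?setTI //; apply: op => c; have [d d0 hd] := hT c.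
  by exists d => // c' /hd[].
exists S; rewrite ?setTI // -openC; apply: op => c; have [d d0 hd] := hT c.
by exists d => // c' /hd[h1 h2] nTc /h2.
Qed.

Section Retraction.
Variables (R : realType) (I : finType) (n : nat) (D : root_datum I n).
Variables (P : Type) (M : apartment_system R n P) (hM : is_masure D M).

Local Notation AA := 'rV[R]_n.
Local Notation refl := (reflection R D).

Lemma MA4_chart A A' f r F : apt M A -> apt M A' -> chart M A f ->
  in_apts M (@splayed_chimney_germ R I n D) r -> MA3_filter D M F ->
  r A -> F A -> r A' -> F A' ->
  exists e k E1 E2, [/\ chart M A' e, r E1, F E2,
    forall z, root_inter D k z -> e z = f z &
    f @` root_inter D k = E1 `|` E2].
Proof.
move=> hA hA' hf hr hF rA FA rA' FA'.
have [phi [hphi [k [kx [E1 [E2 [rE1 FE2 E12]]]]]]] :=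
  MA4 hM hA hA' hf hr hF rA FA rA' FA'.
exists (phi \o f), k, E1, E2; split=> //; first exact: weyl_iso_chart hphi.
by move=> z /kx[].
Qed.

Section Gluing.
Variables (A1 : set P) (hA1 : apt M A1) (F : set (set P)).
Hypothesis (hF : MA3_filter D M F).

(** A chimney germ based at a chamber is solid, and splayed when [Fv] is spherical. So (MA3) joins
    it to [F], and (MA4), applied with this germ in both roles, makes a chart of the new apartment
    agree with [g] on its enclosure. *)
Lemma chamber_apartment g (y : AA) w Fv : chart M A1 g -> weyl D w -> vface D Fv ->
  spherical D Fv -> exists E e k (u : AA) U,
  [/\ apt M E, chart M E e, F E, forall z, root_inter D k z -> e z = g z &
   [/\ closure Fv u, nbhs y U & forall d v : AA, chamber_set D true w d -> U (y + d) ->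
     Fv v -> root_inter D k (y + d + u + v)]].
Proof.
move=> hg hw hFv Fsph.
set G := chimney_germ D (face_filter D y (chamber_set D true w)) Fv.
have hface : face D (face_filter D y (chamber_set D true w)).
  by exists y, (chamber_set D true w); split=> //; apply: vface_chamber_set.
have hr : in_apts M (@splayed_chimney_germ R I n D) (push g G).
  by exists A1, g, G; split=> //; exists (face_filter D y (chamber_set D true w)), Fv.
have hr' : MA3_filter D M (push g G).
  exists A1, g, G; split=> //; right.
  exists (face_filter D y (chamber_set D true w)), Fv; split=> //.
  exact: solid_chamber_chimney.
have [E [hE rE FE]] := MA3 hM hr hF.
have GT : push g G A1.
  have [k [u [U [uF yU _ _]]]] := chimney_germ_elem (rE : G (g @^-1` E)).
  have gA1 z : (g @^-1` A1) z := chart_in hM z hA1 hg.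
  exact: chimney_germ_total uF gA1.
have [e [k [E1 [E2 [he rE1 _ eg E12]]]]] := MA4_chart hA1 hE hg hr hr' GT GT rE rE.
have [k' [u [U [uF yU kE1 hk']]]] := chimney_germ_elem (rE1 : G (g @^-1` E1)).
exists E, e, k', u, U; split=> // z /kE1 zE1; apply: eg.
have : (g @` root_inter D k) (g z) by rewrite E12; left.
by move=> [x xk /(chart_inj hM hA1 hg) <-].
Qed.

Variables (gam : R -> P) (dir : AA).
Hypothesis (Fgam : forall X, F X -> exists2 d : R, 0 < d &
  forall t : R, 0 <= t <= d -> X (gam t)).

(** The initial velocity of the curve in the chart [e] is [dir *m w]. The base point is left free:
    only the linear part has to be followed from one sector-germ to the next. *)
Definition straight (e : AA -> P) (w : 'M[R]_n) := exists (b : AA) (d : R),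
  0 < d /\ forall t : R, 0 <= t <= d -> gam t = e (b + t *: (dir *m w)).

Lemma straight_deep E E' (e e' : AA -> P) w : apt M E -> apt M E' -> chart M E e ->
  chart M E' e' -> F E' -> deep_eq D e e' -> straight e w -> straight e' w.
Proof.
move=> hE hE' he he' FE' ee' [b [d [d0 hd]]].
have [d' d'0 hd'] := Fgam FE'.
exists b, (Num.min d d'); split; first by rewrite lt_min d0.
move=> t /andP[t0]; rewrite le_min => /andP[td td'].
have [|z zE] := chart_surj hM hE' he' (hd' t _); first by rewrite t0.
rewrite -zE; congr e'; symmetry; apply: (deep_eq_point hM hE hE' he he' ee').
by rewrite zE -hd // t0.
Qed.

Lemma straight_comp (e e' : AA -> P) w w' q : e = e' \o affmap w' q ->
  straight e w -> straight e' (w *m w').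
Proof.
move=> -> [b [d [d0 hd]]]; exists (affmap w' q b), d; split=> // t td.
rewrite hd //= /affmap; congr e'.
by rewrite mulmxDl -scalemxAl mulmxA addrAC.
Qed.

Variables (g : AA -> P) (hg : chart M A1 g) (i : I).
Local Notation Fi := (@std_face R I n D (finset.set1 i)).
Local Notation xi := (face_vector R D (finset.set1 i)).

Lemma spherical_panel : spherical D Fi.
Proof.
have xiF := std_face_vector R D (finset.set1 i).
by exists xi; split=> //; apply: generic_panel xiF.
Qed.

(** The chart agrees with [g] on a sub-sector-face of [x + F_i]. That [u] lies in the closure of
    [F_i] is recorded as stability of [F_i] under adding [u], the form in which it is applied. *)
Definition panel_chart E (e : AA -> P) (x : AA) :=
  [/\ apt M E, chart M E e, F E & exists k (u : AA),
   [/\ forall z, root_inter D k z -> e z = g z,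
       forall v, Fi v -> Fi (u + v) &
       forall v, Fi v -> root_inter D k (x + u + v)]].

(** (MA4) for [F] and the panel germ yields a chart [e2] of [E'] that agrees with [e] on an element
    of each. The first agreement transports the velocity; by the second, the transition map from
    [e2] to [e'] fixes [F_i], so that its linear part is [1] or [r_i]. *)
Lemma panel_chart_straight E E' e e' (x : AA) w :
  panel_chart E e x -> panel_chart E' e' x ->
  straight e w -> straight e' w \/ straight e' (w *m refl i).
Proof.
move=> [hE he FE [k [u [ek uF hk]]]] [hE' he' FE' [k' [u' [ek' u'F hk']]]].
move=> [b [d [d0 hd]]]; set y := x + u + u'.
have yk v : Fi v -> root_inter D k (y + v) by move=> /u'F/hk; rewrite addrA.
have yk' v : Fi v -> root_inter D k' (y + v).
  by move=> /uF/hk'; rewrite addrA /y [x + u + u']addrAC.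
set G := chimney_germ D (face_filter D y Fi) Fi.
have hface : face D (face_filter D y Fi).
  by exists y, Fi; split=> //; apply: vface_std_face.
have hr : in_apts M (@splayed_chimney_germ R I n D) (push g G).
  exists A1, g, G; split=> //; exists (face_filter D y Fi), Fi; split=> //.
    exact: vface_std_face.
  exact: spherical_panel.
have rmem k0 X : (forall v, Fi v -> root_inter D k0 (y + v)) ->
    (forall z, root_inter D k0 z -> X (g z)) -> push g G X.
  move=> h hX.
  have [v [v0 [l [lE E1]]]] : G (root_inter D k0).
    apply: chimney_germ_root_inter => //; first by move=> t v; apply: std_face_scale.
    exact: closure_std_face0.
  by exists v; split=> //; exists l; split=> // z /lE/hX.
have rE : push g G E.
  by apply: (rmem k) => // z /ek <-; apply: (chart_in hM _ hE he).
have rE' : push g G E'.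
  by apply: (rmem k') => // z /ek' <-; apply: (chart_in hM _ hE' he').
have [e2 [k2 [E1 [E2 [he2 rE1 FE2 e2e E12]]]]] :=
  MA4_chart hE hE' he hr hF rE FE rE' FE'.
have [_ [w' [q [hw' _ ->]]] e2E] := chart_trans hM hE' he' he2.
have fixk2 z : (E1 `|` E2) (e z) -> e2 z = e z.
  by rewrite -E12 => -[z' z'k /(chart_inj hM hE he) <-]; apply: e2e.
(* On the panel germ [e], [e'] and [e2] all equal [g], so the transition map fixes the points
   [y + (m + v0)]. Subtracting two of these isolates the linear part. *)
have w'fix v : Fi v -> v *m w' = v.
  have [l [s [U [/closure_std_face_add sF yU lE1 hl]]]] :=
    chimney_germ_elem (rE1 : G (g @^-1` E1)).
  have [t t0 ht] := nbhs_line xi yU.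
  have txi : Fi (t *: xi) by apply: std_face_scale => //; apply: std_face_vector.
  pose m := t *: xi + s.
  have key v0 : Fi v0 -> (y + (m + v0)) *m w' + q = y + (m + v0).
    move=> v0F; apply: (chart_inj hM hE' he').
    have mF : Fi (m + v0) by rewrite /m -addrA; apply: std_face_add => //; apply: sF.
    have ge := ek _ (yk _ mF); have ge' := ek' _ (yk' _ mF).
    rewrite ge' -ge -fixk2 ?e2E //; left; rewrite ge; apply: lE1.
    by rewrite /m !addrA; apply: hl => //; apply: ht; rewrite gtr0_norm.
  move=> vF; have xiF := @std_face_vector R I n D (finset.set1 i).
  have k1 := key _ xiF; have := key _ (std_face_add xiF vF).
  rewrite !addrA mulmxDl [LHS]addrAC.
  by move: k1; rewrite !addrA => -> /addrI.
have [d' d'0 hd'] := Fgam FE2.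
have lin : straight e' (w *m w').
  exists (b *m w' + q), (Num.min d d'); split; first by rewrite lt_min d0.
  move=> t /andP[t0]; rewrite le_min => /andP[td td'].
  have td2 : 0 <= t <= d by rewrite t0.
  rewrite hd // -fixk2; last by right; rewrite -hd //; apply: hd'; rewrite t0.
  by rewrite e2E /= /affmap mulmxDl -scalemxAl mulmxA addrAC.
have [w1|wi] := weyl_fix_panel hw' w'fix.
  by left; move: lin; rewrite w1 mulmx1.
by right; move: lin; rewrite wi.
Qed.

(** A chimney based at a chamber and directed by [F_i] contains the panel germs based at all nearby
    points on one side of [y], so one apartment serves an interval of parameters. Sliding the base
    point by [l *: xi] along the panel direction leaves the germ unchanged, and [s = 0] is reached
    by closedness. *)
Lemma panel_chart_side (y : AA) w (d : AA) l :
  weyl D w -> chamber_set D true w d -> 0 <= l ->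
  exists E e (d1 : R), 0 < d1 /\
    forall s : R, 0 <= s <= d1 -> panel_chart E e (y + s *: (d - l *: xi)).
Proof.
move=> hw dD l0.
have [E [e [k [u [U [hE he FE ek [uF yU hk]]]]]]] :=
  chamber_apartment y hg hw (@vface_std_face R I n D (finset.set1 i)) spherical_panel.
have [d1 d10 hd1] := nbhs_line d yU.
have sd s : 0 < s -> chamber_set D true w (s *: d).
  move=> s0; have [v vC <-] := dD; exists (s *: v); first exact: Cvf_scale.
  by rewrite !scale1r scalemxAl.
have lxi v s : 0 <= s -> Fi v -> Fi (s *: xi + v).
  rewrite le_eqVlt => /predU1P[<-|s0 vF]; first by rewrite scale0r add0r.
  by apply: std_face_add => //; apply: std_face_scale => //; apply: std_face_vector.
have hs s v : 0 < s <= d1 -> Fi v -> root_inter D k (y + s *: d + u + v).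
  move=> /andP[s0 sd1] vF; apply: hk => //; first exact: sd.
  by apply: hd1; rewrite gtr0_norm.
exists E, e, d1; split=> // s /andP[s0 sd1]; split=> //.
exists k, ((s * l) *: xi + u); split=> // v vF.
  by rewrite -addrA; apply: lxi; [rewrite mulr_ge0 | apply: closure_std_face_add].
have -> : y + s *: (d - l *: xi) + ((s * l) *: xi + u) + v = y + s *: d + u + v.
  by apply/rowP => j; rewrite !mxE; ring.
have [->|sn0] := eqVneq s 0; last by apply: hs => //; rewrite lt_neqAle eq_sym sn0 s0.
rewrite scale0r addr0; apply: (root_inter_closed (v := d) d10) => t td.
have -> : y + u + v + t *: d = y + t *: d + u + v.
  by apply/rowP => j; rewrite !mxE; ring.
exact: hs.
Qed.

End Gluing.
End Retraction.

Section Galleries.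
Variables (R : realType) (I : finType) (n : nat) (D : root_datum I n).
Variables (P : Type) (M : apartment_system R n P) (hM : is_masure D M).

Local Notation AA := 'rV[R]_n.
Local Notation al := (srootR R D).
Local Notation refl := (reflection R D).
Local Notation c i j := ((cartan D i j)%:~R : R).

Variables (A1 : set P) (hA1 : apt M A1) (F : set (set P)).
Hypothesis (hF : MA3_filter D M F).
Variables (gam : R -> P) (dir : AA).
Hypothesis (Fgam : forall X, F X -> exists2 d : R, 0 < d &
  forall t : R, 0 <= t <= d -> X (gam t)).

(* The panel germs [y + t *: et + u + F_i], as [t] varies, lead from one chamber
   at infinity to the adjacent one; the set of the [t] for which an apartment
   containing [F] and this germ has velocity [w] or [w r_i] is clopen. *)
Lemma adjacent_straight g i E0 e0 k0 (y0 : AA) E1 e1 k1 (y1 : AA) w :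
  chart M A1 g ->
  [/\ apt M E0, chart M E0 e0, F E0, forall z, root_inter D k0 z -> e0 z = g z &
      forall v, Cvf D v -> root_inter D k0 (y0 + v)] ->
  [/\ apt M E1, chart M E1 e1, F E1, forall z, root_inter D k1 z -> e1 z = g z &
      forall v, Cvf D v -> root_inter D k1 (y1 + v *m refl i)] ->
  straight gam dir e0 w ->
  straight gam dir e1 w \/ straight gam dir e1 (w *m refl i).
Proof.
move=> hg [hE0 he0 FE0 e0g k0C] [hE1 he1 FE1 e1g k1C] st0.
set xi := face_vector R D (finset.set1 i); set et := coweight R D i.
have xii : pairing xi (al i) = 0 by rewrite pairing_face_vector !inE eqxx.
have xij j : j != i -> pairing xi (al j) = 1.
  by move=> ji; rewrite pairing_face_vector !inE ji.
have eti : pairing et (al i) = 1 by rewrite pairing_coweight eqxx.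
have etj j : j != i -> pairing et (al j) = 0.
  by move=> ji; rewrite pairing_coweight eq_sym (negPf ji).
(* Since [r_i] is an involution, this alternative is stable under every change of apartment along a
   panel germ. *)
pose lin e := straight gam dir e w \/ straight gam dir e (w *m refl i).
have tr E e E' e' x : panel_chart D M F g i E e x -> panel_chart D M F g i E' e' x ->
    lin e -> lin e'.
  move=> h h' []; first exact: (panel_chart_straight hM hA1 hF Fgam hg h h').
  move=> /(panel_chart_straight hM hA1 hF Fgam hg h h')[]; first by right.
  by rewrite -mulmxA reflK mulmx1; left.
(* The bound [l] is chosen so that, for [j != i], the two extreme base points satisfy the
   inequalities of their sectors, and so that [- et + l *: xi] lies in the chamber reflected by
   [r_i]. *)
pose b j := `|pairing y0 (al j)| + `|pairing y1 (al j)| + `|c i j|.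
pose l := 1 + \sum_j b j.
have bl j : b j < l.
  rewrite /l ltr_pwDl // le_sum_finite // => k.
  by rewrite !addr_ge0.
have l0 : 0 < l by rewrite ltr_pwDl // sumr_ge0 // => j _; rewrite !addr_ge0.
have lbound j : [/\ pairing y0 (al j) < l, pairing y1 (al j) - c i j < l &
                    - c i j < l].
  have := bl j; rewrite /b.
  have := ler_norm (pairing y0 (al j)); have := ler_norm (pairing y1 (al j)).
  have := ler_norm (- c i j); rewrite normrN.
  have := normr_ge0 (pairing y0 (al j)); have := normr_ge0 (pairing y1 (al j)).
  by have := normr_ge0 (c i j); split; lra.
pose y := l *: xi.
pose T t := exists E e, panel_chart D M F g i E e (y + t *: et) /\ lin e.
have Tlc : forall a a', T a -> T a'.
  apply: locally_constant => t.
  have dp : chamber_set D true 1%:M (et + xi).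
    rewrite chamber_set1 => j; rewrite pairingDl.
    by have [->|ji] := eqVneq j i; rewrite ?eti ?xii ?etj ?xij ?addr0 ?add0r.
  have dm : chamber_set D true (refl i) (- et + l *: xi).
    exists ((- et + l *: xi) *m refl i); last by rewrite scale1r -mulmxA reflK mulmx1.
    move=> j; rewrite pairing_refl !pairingDl !pairingNl !pairingZl eti xii mulr0 addr0.
    have [->|ji] := eqVneq j i; first by rewrite eti xii cartanii; lra.
    by have [_ _] := lbound j; rewrite etj ?xij //; lra.
  have [Ep [ep [sp [sp0 hp]]]] :=
    panel_chart_side hM hA1 hF hg i (y + t *: et) (weyl1 R D) dp ler01.
  have [Em [em [sm [sm0 hm]]]] :=
    panel_chart_side hM hA1 hF hg i (y + t *: et) (weyl_refl R D i) dm (ltW l0).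
  have hp' s : 0 <= s <= sp -> panel_chart D M F g i Ep ep (y + (t + s) *: et).
    by move=> /hp; rewrite scale1r addrK scalerDl addrA.
  have hm' s : 0 <= s <= sm -> panel_chart D M F g i Em em (y + (t - s) *: et).
    by move=> /hm; rewrite addrK scalerN scalerBl addrA.
  have side E e t' : panel_chart D M F g i E e (y + t *: et) ->
      panel_chart D M F g i E e (y + t' *: et) -> (T t <-> T t').
    move=> h h'; split=> -[E' [e' [h1 h2]]]; exists E, e; split=> //.
      exact: (tr _ _ _ _ _ h1 h h2).
    exact: (tr _ _ _ _ _ h1 h' h2).
  exists (Num.min sp sm); first by rewrite lt_min sp0.
  move=> t' ht'; have [tt'|t't] := lerP t t'.
    apply: (side Ep ep).
      by have := hp' 0; rewrite addr0 lexx ltW //; apply.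
    have := hp' (t' - t); rewrite subrKC; apply; rewrite subr_ge0 tt' /=.
    by apply: le_trans (ler_norm _) _; rewrite (le_trans ht') // ge_min lexx.
  apply: (side Em em).
    by have := hm' 0; rewrite subr0 lexx ltW //; apply.
  have := hm' (t - t'); rewrite subKr; apply; rewrite subr_ge0 ltW //=.
  apply: le_trans (ler_norm _) _; rewrite distrC (le_trans ht') //.
  by rewrite ge_min lexx orbT.
(* The parameters [alpha_i(y0) + 1] here and [alpha_i(y1) - 1] below put the panel strictly on the
   required side of the wall direction of each sector. *)
have g0 : panel_chart D M F g i E0 e0 (y + (pairing y0 (al i) + 1) *: et).
  split=> //; exists k0, 0; split=> // v vF; first by rewrite add0r.
  rewrite addr0 -(addr_subA _ y0); apply: k0C.
  rewrite addrC; apply: Cvf_add_ge0 => [j|j].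
    by have := vF j; case: ifP => _ => [->|/ltW].
  rewrite /y pairingBl pairingDl !pairingZl.
  have [->|ji] := eqVneq j i; first by rewrite xii eti; lra.
  by have [h _ _] := lbound j; rewrite xij // etj //; lra.
have g1 : panel_chart D M F g i E1 e1 (y + (pairing y1 (al i) - 1) *: et).
  split=> //; exists k1, 0; split=> // v vF; first by rewrite add0r.
  rewrite addr0 -(addr_subA _ y1).
  set z := (_ - y1 + v); have -> : z = (z *m refl i) *m refl i.
    by rewrite -mulmxA reflK mulmx1.
  apply: k1C => j; rewrite pairing_refl /z /y !(pairingBl, pairingDl) !pairingZl.
  have := vF i; rewrite inE eqxx => vi.
  have [->|ji] := eqVneq j i; first by rewrite xii eti vi cartanii; lra.
  have := vF j; rewrite inE (negPf ji) => vj.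
  by have [_ h _] := lbound j; rewrite xij // etj // xii eti vi; nra.
have [E [e [h hlin]]] : T (pairing y1 (al i) - 1).
  by apply: (Tlc (pairing y0 (al i) + 1)); exists E0, e0; split=> //; left.
exact: tr h g1 hlin.
Qed.

End Galleries.

(** * Galleries at infinity *)

Section GalleryWords.
Variables (R : realType) (I : finType) (n : nat) (D : root_datum I n).
Variables (P : Type) (M : apartment_system R n P) (hM : is_masure D M).

Local Notation AA := 'rV[R]_n.
Local Notation refl := (reflection R D).

Lemma spherical_chamber (w : 'M[R]_n) : weyl D w -> spherical D (chamber_set D true w).
Proof.
move=> hw; exists (face_vector R D finset.set0 *m w); split.
  by exists (face_vector R D finset.set0); [apply: Cvf_face_vector | rewrite scale1r].
apply: generic_weyl => //; apply: generic_Cvf; exact: Cvf_face_vector.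
Qed.

Lemma sector_apartment A1 F g w : apt M A1 -> MA3_filter D M F -> chart M A1 g ->
  weyl D w -> exists E e k (y : AA),
  [/\ apt M E, chart M E e, F E, forall z, root_inter D k z -> e z = g z &
      forall v, Cvf D v -> root_inter D k (y + v *m w)].
Proof.
move=> hA1 hF hg hw.
have [E [e [k [u [U [hE he FE ek [_ U0 hk]]]]]]] := chamber_apartment hM hA1 hF 0
  hg hw (vface_chamber_set true hw) (spherical_chamber hw).
pose r := face_vector R D finset.set0 *m w.
have [d d0 hd] := nbhs_line r U0.
exists E, e, k, (d *: r + u); split=> // v vC; rewrite -[d *: r]add0r.
apply: hk; last by exists v; rewrite ?scale1r.
  exists (d *: face_vector R D finset.set0); last by rewrite scale1r -scalemxAl.
  by apply: Cvf_scale => //; apply: Cvf_face_vector.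
by apply: hd; rewrite gtr0_norm.
Qed.

Lemma deep_eq_root_inter (e g : AA -> P) k (y : AA) :
  (forall z, root_inter D k z -> e z = g z) ->
  (forall v, Cvf D v -> root_inter D k (y + v)) -> deep_eq D e g.
Proof. by move=> h hk; exists y => v /hk/h. Qed.

(** One adjacency per letter of [w]. Passing from [e1] to the chart [e2] turned by [r_i] multiplies
    the velocity by [r_i], so the two cases of an adjacency contribute [refl i *m l] and [l]: the
    list holds products of subwords of a word for the inverse of [w]. It is chosen before the
    apartments, the germ and the curve, whence a uniform constant. *)
Lemma gallery_straight w : weyl D w -> exists L : seq 'M[R]_n,
  forall A1 (g g' : AA -> P) q, apt M A1 -> chart M A1 g ->
    coroot_lattice D q -> g' = g \o affmap w q ->
  forall F (gam : R -> P) (dir : AA), MA3_filter D M F ->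
    (forall X, F X -> exists2 d : R, 0 < d &
      forall t : R, 0 <= t <= d -> X (gam t)) ->
  forall E (e : AA -> P) E' (e' : AA -> P) w0,
    apt M E -> chart M E e -> F E -> deep_eq D e g ->
    apt M E' -> chart M E' e' -> F E' -> deep_eq D e' g' ->
    straight gam dir e w0 ->
    exists2 l, l \in L & straight gam dir e' (w0 *m l).
Proof.
elim=> [|i w' hw' [L hL]].
  exists [:: 1%:M] => A1 g g' q hA1 hg hq g'E F gam dir hF Fgam E e E' e' w0.
  move=> hE he FE eg hE' he' FE' e'g' st; exists 1%:M; rewrite ?inE // mulmx1.
  have hq' : affine_weyl D (affmap 1%:M q) by exists 1%:M, q; split=> //; apply: weyl1.
  have eE : e = (e \o affmap 1%:M q) \o affmap 1%:M (- q).
    rewrite -compA affmap_comp mulmx1 mulmx1 addNr affmap1.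
    by [].
  have := straight_comp eE st; rewrite mulmx1.
  apply: (straight_deep hM Fgam hE hE' (chart_comp hM hE he hq') he' FE').
  apply: deep_eq_trans (deep_eq_sym e'g'); rewrite g'E.
  have affE h : h \o affmap (1%:M : 'M[R]_n) q = (fun x => h (x + q)) :> (AA -> P).
    by apply/funext => x; rewrite /= /affmap mulmx1.
  by rewrite !affE; apply: deep_eq_translate.
exists (L ++ [seq refl i *m l | l <- L]).
move=> A1 g g' q hA1 hg hq g'E F gam dir hF Fgam E e E' e' w0.
move=> hE he FE eg hE' he' FE' e'g' st.
pose h := g \o affmap (refl i) q.
have hh : chart M A1 h.
  by apply: (chart_comp hM) => //; exists (refl i), q; split=> //; apply: weyl_refl.
have g'h : g' = h \o affmap w' 0.
  by rewrite g'E /h -compA affmap_comp mul0mx add0r.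
have [E0 [e0 [k0 [y0 [hE0 he0 FE0 ek0 hk0]]]]] :=
  sector_apartment hA1 hF hg (weyl1 R D).
have [E1 [e1 [k1 [y1 [hE1 he1 FE1 ek1 hk1]]]]] :=
  sector_apartment hA1 hF hg (weyl_refl R D i).
have {}hk0 v : Cvf D v -> root_inter D k0 (y0 + v) by move=> /hk0; rewrite mulmx1.
have st0 : straight gam dir e0 w0.
  apply: (straight_deep hM Fgam hE hE0 he he0 FE0 _ st).
  by apply: deep_eq_trans eg (deep_eq_sym (deep_eq_root_inter ek0 hk0)).
pose e2 := e1 \o affmap (refl i) q.
have he2 : chart M E1 e2.
  by apply: (chart_comp hM) => //; exists (refl i), q; split=> //; apply: weyl_refl.
have e2h : deep_eq D e2 h.
  exists ((y1 - q) *m refl i) => v vC; rewrite /e2 /h /=.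
  have -> : affmap (refl i) q ((y1 - q) *m refl i + v) = y1 + v *m refl i.
    by rewrite /affmap mulmxDl -mulmxA reflK mulmx1 addrAC subrK.
  by apply/ek1/hk1.
have e1E : e1 = e2 \o affmap (refl i) (- q *m refl i).
  rewrite /e2 -compA affmap_comp reflK -mulmxA reflK mulmx1 addNr affmap1.
  by [].
have next w1 : straight gam dir e1 w1 ->
    exists2 l, l \in L & straight gam dir e' (w1 *m refl i *m l).
  move=> st1; have st2 := straight_comp e1E st1.
  exact: (hL A1 h g' 0 hA1 hh (coroot_lattice0 _ _) g'h F gam dir hF Fgam
           E1 e2 E' e' _ hE1 he2 FE1 e2h hE' he' FE' e'g' st2).
have [/next|/next] := adjacent_straight hM hA1 hF Fgam hg
  (And5 hE0 he0 FE0 ek0 hk0) (And5 hE1 he1 FE1 ek1 hk1) st0.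
  move=> [l lL hl]; exists (refl i *m l); last by rewrite mulmxA.
  by rewrite mem_cat map_f ?orbT.
move=> [l lL]; rewrite -(mulmxA w0) reflK mulmx1 => hl.
by exists l; rewrite // mem_cat lL.
Qed.

End GalleryWords.

(** * Positions seen from a sector-germ *)

(** The local bound compares [th] only with its value at the centre. Let [tau] be the supremum of
    the parameters up to which the estimate from 0 holds: the bound to its left shows that [tau] is
    attained, the bound to its right that it equals 1. *)
Lemma local_lipschitz (R : realType) n (N : 'rV[R]_n -> R) (th : R -> 'rV[R]_n) K :
  seminorm N ->
  (forall c : R, exists2 d : R, 0 < d & forall c' : R, `|c' - c| <= d ->
     N (th c' - th c) <= K * `|c' - c|) ->
  N (th 1 - th 0) <= K.
Proof.
move=> hN hloc; pose S : set R := [set c | 0 <= c <= 1 /\ N (th c - th 0) <= K * c].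
have tri a b c : N (th a - th c) <= N (th a - th b) + N (th b - th c).
  by apply: le_trans (hN.1 _ _); rewrite addrA subrK.
have S0 : S 0.
  by rewrite /S /= lexx ler01 subrr mulr0 (seminorm0 hN) lexx.
have Sub : has_ubound S by exists 1 => c [/andP[]].
have Ssup : has_sup S by split=> //; exists 0.
set tau := sup S.
have tau0 : 0 <= tau by apply: ub_le_sup S0.
have tau1 : tau <= 1 by apply: ge_sup => [|c [/andP[]]//]; exists 0.
have [d d0 hd] := hloc tau.
have Stau : S tau.
  split; first by rewrite tau0.
  have [c Sc cd] := sup_adherent d0 Ssup.
  have ct : c <= tau by apply: ub_le_sup Sc.
  have [_ hc] := Sc.
  have cd' : tau - c <= d by rewrite -/tau in cd; lra.
  have := hd c; rewrite distrC ger0_norm ?subr_ge0 // => /(_ cd') h.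
  apply: le_trans (tri tau c 0) _; rewrite -(seminormN (th tau - _)) // opprB.
  by move: h hc; rewrite mulrBr; lra.
have [t1|t1] := ltP tau 1; last first.
  by have [_] := Stau; rewrite (le_anti (introT andP (conj tau1 t1))) mulr1.
pose c := Num.min 1 (tau + d).
have ct : tau < c by rewrite lt_min t1 ltrDl.
suff Sc : S c.
  have : c <= tau by apply: ub_le_sup Sc.
  by rewrite leNgt ct.
split; first by rewrite (le_trans tau0 (ltW ct)) ge_min lexx.
have cd : c - tau <= d by rewrite lerBlDl ge_min lexx orbT.
have := hd c; rewrite ger0_norm ?subr_ge0 ?(ltW ct) // => /(_ cd).
rewrite mulrBr => h1; have := Stau.2 => h2.
by apply: le_trans (tri c tau 0) _; lra.
Qed.

Section Coordinates.
Variables (R : realType) (I : finType) (n : nat) (D : root_datum I n).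
Variables (P : Type) (M : apartment_system R n P) (hM : is_masure D M).

Local Notation AA := 'rV[R]_n.
Local Notation al := (srootR R D).

Lemma segment_face_MA3 B f p eps : apt M B -> chart M B f ->
  MA3_filter D M (push f (segment_face D p eps)).
Proof.
move=> hB hf; exists B, f, (segment_face D p eps); split=> //; right.
exists (face_filter D p (chamber_set D eps 1%:M)), (std_face D finset.setT).
split=> //.
- exists p, (chamber_set D eps 1%:M); split=> //.
  by apply: vface_chamber_set; apply: weyl1.
- exact: vface_std_face.
- by apply: solid_chamber_chimney; [exact: weyl1 | exact: vface_std_face].
Qed.

(** Lets (MA3) reach a sector-germ: an apartment containing this chimney germ contains a
    subsector. *)
Lemma chamber_germ_MA3 A1 f : apt M A1 -> chart M A1 f ->
  exists2 F, MA3_filter D M F & F `<=` chart_germ D f.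
Proof.
move=> hA1 hf; pose C := chamber_set D true (1%:M : 'M[R]_n).
have hC : vface D C by apply: vface_chamber_set; apply: weyl1.
exists (push f (chimney_germ D (face_filter D 0 C) C)).
  exists A1, f, (chimney_germ D (face_filter D 0 C) C); split=> //; right.
  exists (face_filter D 0 C), C; split=> //; first by exists 0, C.
  by apply: solid_chamber_chimney => //; apply: weyl1.
move=> X /chimney_germ_elem[k [u [U [_ U0 kX hk]]]]; apply/chart_germE.
have rC := Cvf_face_vector R D.
have [d d0 hd] := nbhs_line (face_vector R D finset.set0) U0.
exists (d *: face_vector R D finset.set0 + u) => v vC; apply: kX.
rewrite -[d *: _]add0r; apply: hk; rewrite /C ?chamber_set1 //.
  exact: Cvf_scale.
by apply: hd; rewrite gtr0_norm.
Qed.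

Variables (A1 : set P) (f1 : AA -> P) (hA1 : apt M A1) (hf1 : chart M A1 f1).

Definition coordinate (x : P) (z : AA) := exists E e,
  [/\ apt M E, chart M E e, deep_eq D e f1 & x = e z].

Lemma coordinate_uniq x z z' : coordinate x z -> coordinate x z' -> z = z'.
Proof.
move=> [E [e [hE he ef ->]]] [E' [e' [hE' he' ef' ee']]].
apply: (deep_eq_point hM hE hE' he he' _ ee').
exact: deep_eq_trans ef (deep_eq_sym ef').
Qed.

Lemma based_apartment F : MA3_filter D M F -> exists E e,
  [/\ apt M E, chart M E e, F E & deep_eq D e f1].
Proof.
move=> hF; have [E [e [k [y [hE he FE ek hk]]]]] :=
  sector_apartment hM hA1 hF hf1 (weyl1 R D).
exists E, e; split=> //; apply: (deep_eq_root_inter (y := y) ek) => v /hk.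
by rewrite mulmx1.
Qed.

Lemma segment_apartment f p eps v : Cvf D v ->
  forall X, push f (segment_face D p eps) X -> exists2 d : R, 0 < d &
  forall t : R, 0 <= t <= d -> (X : set P) (f (p + t *: (sgn R eps *: v))).
Proof. by move=> vC X hX; apply: (segment_face_elem vC hX). Qed.

Lemma coordinate_ex x : exists z, coordinate x z.
Proof.
have : (\bigcup_(A in apt M) A) x by rewrite (masure_cover hM).
move=> [B hB Bx]; have [f hf] := apt_chart hM hB.
have [p <-] := chart_surj hM hB hf Bx.
have [E [e [hE he FE ef]]] := based_apartment (segment_face_MA3 p true hB hf).
have [d d0 hd] := segment_apartment (Cvf_face_vector R D) FE.
(* The segment face contains its base point, hence the apartment contains [x] itself and not merely
   a chamber near it. *)
have := hd 0; rewrite lexx ltW // scale0r addr0 => /(_ isT).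
by move=> /(chart_surj hM hE he)[z ze]; exists z, E, e.
Qed.

Definition position x : AA := xget 0 [set z | coordinate x z].

Lemma positionE x z : coordinate x z -> position x = z.
Proof.
move=> xz; apply: (coordinate_uniq _ xz).
have ex : exists z, [set z | coordinate x z] z by exists z.
exact: (xgetPex 0 ex).
Qed.

Lemma seminorm_list_bound (L : seq 'M[R]_n) N : is_norm N ->
  exists2 K, 0 <= K & forall l, l \in L -> forall x : AA, N (x *m l) <= K * N x.
Proof.
move=> hN; elim: L => [|l L [K K0 hK]]; first by exists 0.
have [K' K'0 hK'] := seminorm_le_is_norm (seminorm_mulmx l (is_norm_seminorm hN)) hN.
exists (K + K'); first exact: addr_ge0.
have N0 x := seminorm_ge0 x (is_norm_seminorm hN).
move=> l'; rewrite inE => /predU1P[->|/hK h] x; rewrite mulrDl.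
  by apply: le_trans (hK' x) _; rewrite lerDr mulr_ge0.
by apply: le_trans (h x) _; rewrite lerDl mulr_ge0.
Qed.

Lemma position_chamber_lipschitz At ft N : apt M At -> chart M At ft ->
  is_norm N -> exists2 K, 0 <= K & forall B f, apt M B -> chart M B f ->
    deep_eq D f ft -> forall p v : AA, Cvf D v ->
    N (position (f (p + v)) - position (f p)) <= K * N v.
Proof.
move=> hAt hft hN; have hp := is_norm_seminorm hN.
have [F0 hF0 F0f1] := chamber_germ_MA3 hA1 hf1.
(* The apartment [C] contains both sector-germs, and [w] is the linear part of the change between
   charts adapted to each. The list [L] and the constant [K] are thus fixed before [B] and the
   segment. *)
have [C [g [k [y [hC hg F0C gk hk]]]]] :=
  sector_apartment hM hAt hF0 hft (weyl1 R D).
have gft : deep_eq D g ft.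
  by apply: (deep_eq_root_inter (y := y) gk) => v /hk; rewrite mulmx1.
have [g' hg' g'f1] := germ_based_chart hM hA1 hf1 hC (F0f1 _ F0C).
have [_ [w [q [hw hq ->]]] g'E] := chart_trans hM hC hg hg'.
have [L hL] := gallery_straight hM hw.
have [K K0 hK] := seminorm_list_bound L hN.
exists K => // B f hB hf fft p v vC.
(* Both signs are needed: the local estimate has to hold on either side of each parameter. *)
have key c eps : exists2 d : R, 0 < d & forall t : R, 0 <= t <= d ->
    N (position (f (p + c *: v + t *: (sgn R eps *: v))) -
       position (f (p + c *: v))) <= K * N v * t.
  set p' := p + c *: v; have hF := segment_face_MA3 p' eps hB hf.
  have [E [e [hE he FE ef1]]] := based_apartment hF.
  pose gam t := f (p' + t *: (sgn R eps *: v)).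
  have Fgam := segment_apartment (f := f) (p := p') (eps := eps) vC.
  have FB : push f (segment_face D p' eps) B.
    have [u [uF _]] := FE.
    have fB z : (f @^-1` B) z := chart_in hM z hB hf.
    exact: chimney_germ_total uF fB.
  have st : straight gam (sgn R eps *: v) f 1%:M.
    by exists p', 1; split=> // t _; rewrite mulmx1.
  have [l lL [b [d [d0 hd]]]] := hL C g g' q hC hg hq g'E _ gam (sgn R eps *: v)
    hF Fgam B f E e 1%:M hB hf FB (deep_eq_trans fft (deep_eq_sym gft)) hE he FE
    (deep_eq_trans ef1 (deep_eq_sym g'f1)) st.
  rewrite mul1mx in hd.
  have pos t : 0 <= t <= d -> position (gam t) = b + t *: (sgn R eps *: v *m l).
    by move=> td; apply: positionE; exists E, e; split=> //; apply: hd.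
  have sgn1 : `|sgn R eps| = 1 by rewrite /sgn; case: (eps); rewrite ?normrN normr1.
  exists d => // t /andP[t0 td]; rewrite -/(gam t).
  have -> : f p' = gam 0 by rewrite /gam scale0r addr0.
  have h0 : 0 <= (0 : R) <= d by rewrite lexx ltW.
  have ht : 0 <= t <= d by rewrite t0.
  rewrite (pos _ ht) (pos _ h0) scale0r addr0 addrC addKr.
  rewrite hp.2 -scalemxAl hp.2 ger0_norm // mulrC ler_wpM2r // sgn1 mul1r.
  exact: hK.
pose th c := position (f (p + c *: v)).
have -> : position (f (p + v)) - position (f p) = th 1 - th 0.
  by rewrite /th scale1r scale0r addr0.
apply: local_lipschitz => // c.
have [dp dp0 hdp] := key c true; have [dm dm0 hdm] := key c false.
exists (Num.min dp dm); first by rewrite lt_min dp0.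
move=> c' hc'; have [cc'|c'c] := lerP c c'.
  have := hdp (c' - c); rewrite scale1r -addrA -scalerDl subrKC; apply.
  rewrite subr_ge0 cc' /=; apply: le_trans (ler_norm _) (le_trans hc' _).
  by rewrite ge_min lexx.
have := hdm (c - c'); rewrite scaleN1r scalerN -addrA -scalerBl subKr.
apply; rewrite subr_ge0 ltW //=.
apply: le_trans (ler_norm _) _; rewrite distrC (le_trans hc') //.
by rewrite ge_min lexx orbT.
Qed.

(** Adding a multiple of [r] proportional to [N v] makes all simple roots positive, since each of
    them is bounded by [K * N]; subtracting that multiple again costs only a constant factor. *)
Lemma chamber_decomposition N : is_norm N -> exists2 K, 0 <= K &
  forall v : AA, exists u u', [/\ Cvf D u, Cvf D u', v = u - u' &
    v != 0 -> N u + N u' <= K * N v].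
Proof.
move=> hN; have hp := is_norm_seminorm hN.
have N0 x := seminorm_ge0 x hp; have rC := Cvf_face_vector R D.
set r := face_vector R D finset.set0 in rC *.
have [K K0 hK] : exists2 K, 0 <= K &
    forall i (v : AA), `|pairing v (al i)| <= K * N v.
  suff [K K0 hK] : exists2 K, 0 <= K & forall i, i \in enum I ->
      forall v : AA, `|pairing v (al i)| <= K * N v.
    by exists K => // i; apply: hK; rewrite mem_enum.
  elim: (enum I) => [|i s [K K0 hK]]; first by exists 0.
  have [K' K'0 hK'] := seminorm_le_is_norm (seminorm_pairing (al i)) hN.
  exists (K + K'); first exact: addr_ge0.
  move=> j; rewrite inE => /predU1P[->|/hK h] v; rewrite mulrDl.
    by apply: le_trans (hK' v) _; rewrite lerDr mulr_ge0.
  by apply: le_trans (h v) _; rewrite lerDl mulr_ge0.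
exists (1 + 2 * (K + 1) * N r); first by rewrite addr_ge0 // !mulr_ge0 // addr_ge0.
(* For [v = 0] the proportional multiple of [r] would be 0, outside the open chamber; hence the pair
   [r], [r] and the guard on the estimate. *)
move=> v; have [->|v0] := eqVneq v 0; first by exists r, r; rewrite subrr.
have Nv : 0 < N v.
  rewrite lt_neqAle N0 andbT eq_sym; apply: contra v0 => /eqP.
  by case: hN => _ _ h /h->.
have l0 : 0 < (K + 1) * N v by rewrite mulr_gt0 // ltr_wpDl.
exists (v + ((K + 1) * N v) *: r), (((K + 1) * N v) *: r); split.
- move=> i; rewrite pairingDl pairingZl pairing_face_vector inE mulr1.
  by have := hK i v; rewrite ler_norml => /andP[h _]; lra.
- exact: Cvf_scale.
- by rewrite addrK.
move=> _; apply: le_trans (lerD (hp.1 _ _) (lexx _)) _.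
by rewrite hp.2 gtr0_norm //; lra.
Qed.

Lemma position_lipschitz At ft N : apt M At -> chart M At ft -> is_norm N ->
  exists2 K, 0 <= K & forall B f, apt M B -> chart M B f ->
    chart_germ D f = chart_germ D ft ->
    forall z z', N (position (f z) - position (f z')) <= K * N (z - z').
Proof.
move=> hAt hft hN; have hp := is_norm_seminorm hN.
have [K K0 hK] := position_chamber_lipschitz hAt hft hN.
have [K' K'0 hK'] := chamber_decomposition hN.
exists (K * K'); first exact: mulr_ge0.
move=> B f hB hf fft.
have Bft : chart_germ D ft B.
  rewrite -fft; apply/chart_germE; exists 0 => v _; exact: (chart_in hM _ hB hf).
have [f' hf' f'ft] := germ_based_chart hM hAt hft hB Bft.
(* Equality of germs leaves a translation undetermined, which differences do not see. *)
have [q ->] : exists q, f = fun x => f' (x + q).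
  apply: (same_germ_charts hM hB hf' hf).
  by rewrite (deep_eq_germ f'ft) fft.
move=> z z'; have [->|zz'] := eqVneq z z'.
  by rewrite !subrr (seminorm0 hp) mulr0.
have [u [u' [uC u'C zE hu]]] := hK' (z - z').
have Nuu' : N u + N u' <= K' * N (z - z') by apply: hu; rewrite subr_eq0.
have h1 := hK B f' hB hf' f'ft (z' + q) u uC.
have h2 := hK B f' hB hf' f'ft (z + q) u' u'C.
have e12 : z + q + u' = z' + q + u.
  have -> : u = z - z' + u' by rewrite zE subrK.
  by rewrite [z' + q + _]addrAC addr_subA addrAC.
rewrite e12 -(seminormN _ hp) opprB in h2.
set a := position (f' (z + q)) in h2 *; set b := position (f' (z' + q)) in h1 *.
set m := position _ in h1 h2.
have -> : a - b = (a - m) + (m - b) by rewrite addrA subrK.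
apply: le_trans (hp.1 _ _) _; rewrite -mulrA.
by apply: le_trans (lerD h2 h1) _; rewrite -mulrDr ler_wpM2l // addrC.
Qed.

Lemma retraction_position A s rho : s = chart_germ D f1 ->
  is_retraction D M A s rho ->
  exists2 fA, chart M A fA & forall x, rho x = fA (position x).
Proof.
move=> sE [hA sA hrho]; rewrite sE in sA.
have [fA hfA fAf1] := germ_based_chart hM hA1 hf1 hA sA.
exists fA => // x; have [Ax [phi [hAx xAx sAx [hphi hfix ->]]]] := hrho x.
rewrite sE in sAx hfix.
have [fx hfx fxf1] := germ_based_chart hM hA1 hf1 hAx sAx.
have [z zx] := chart_surj hM hAx hfx xAx.
rewrite (positionE (z := z)); last by exists Ax, fx.
have [_ [[[w [q [hw _ ->]]] _] aE]] := hphi fx fA hfx hfA.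
(* Read in charts that agree deep in [s], the isomorphism [phi] is an affine map fixing a subsector,
   hence the identity. *)
have [y hy] : exists y, forall v, Cvf D v -> affmap w q (y + v) = y + v.
  have /chart_germE[y1 h1] := hfix.
  have [y2 h2] := deep_eq_trans fxf1 (deep_eq_sym fAf1).
  have [y3 h3] := fxf1.
  have [y4 [y41 y42]] := deep_two D y1 y2; have [y5 [y53 y54]] := deep_two D y3 y4.
  exists y5 => v vC; apply: (chart_inj hM hA hfA).
  rewrite -[LHS]/((fA \o affmap w q) (y5 + v)) -aE /=.
  have dd b : Cvf D (y4 - b) -> Cvf D (y5 - b + v).
    move=> hb; have -> : y5 - b + v = (y5 - y4) + (y4 - b) + v by rewrite addrA subrK.
    by do 2![apply: Cvf_add => //].
  have fxE : fx (y5 + v) = f1 (y5 + v).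
    by rewrite -(addr_subA y5 y3) h3 //; apply: Cvf_add.
  have fxA : fx (y5 + v) = fA (y5 + v).
    by rewrite -(addr_subA y5 y2) h2 //; apply: dd.
  rewrite -fxA fxE; have [_] := h1 _ (dd _ y41).
  by rewrite addr_subA.
have rC := Cvf_face_vector R D; set r := face_vector R D finset.set0 in rC.
have w1 : w = 1%:M.
  apply: (weyl_fix_vector hw rC); have e1 := hy _ rC.
  have := hy _ (Cvf_add rC rC).
  by rewrite /affmap addrA mulmxDl [LHS]addrAC -/(affmap w q (y + r)) e1 => /addrI.
have q0 : q = 0.
  have := hy _ rC; rewrite w1 /affmap mulmx1 => /eqP.
  by rewrite -subr_eq0 addrAC subrr add0r => /eqP.
by rewrite -zx -[LHS]/((phi \o fx) z) aE w1 q0 /= /affmap mulmx1 addr0.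
Qed.

(** * Translations [x +_t u] read in charts *)

Lemma signed_infty_true : signed_infty D true = germ_infty 0 (@Cvf R I n D).
Proof.
rewrite /signed_infty; congr germ_infty; apply/seteqP.
split=> [_ [v vC <-]|v vC]; first by rewrite scale1r.
by exists v => //; rewrite scale1r.
Qed.

(** A vectorially Weyl isomorphism may involve a translation outside the coroot lattice, so it need
    not be a chart. Splitting this translation off leaves a chart with the same germ. *)
Lemma model_iso_chart A psi t : apt M A -> model_iso D M A psi ->
  push psi (signed_infty D true) = t ->
  exists f q, [/\ chart M A f, chart_germ D f = t & psi = fun x => f (x + q)].
Proof.
move=> hA [f [_ [hf [[w [q [hw _ ->]]] _] ->]]] tE.
have f'c : chart M A (f \o affmap w 0).
  by apply: (chart_comp hM) => //; apply: affine_weyl_linear.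
have psiE : f \o affmap w q = fun x => (f \o affmap w 0) (x + q *m invmx w).
  apply/funext => x; rewrite /= /affmap addr0 mulmxDl mulmxKV //.
  exact: weyl_unit hw.
exists (f \o affmap w 0), (q *m invmx w); split=> //.
rewrite -tE psiE signed_infty_true.
apply/seteqP; split=> E /chart_germE[y h]; apply/chart_germE.
  exists (y - q *m invmx w) => v vC.
  by rewrite addrAC subrK; apply: h.
by exists (y + q *m invmx w) => v vC; rewrite addrAC; apply: h.
Qed.

Lemma model_iso_of_chart A f : chart M A f -> model_iso D M A f.
Proof.
move=> hf; exists f, id; split=> //; split.
  by exists 1%:M, 0; split=> //; [exact: weyl1 | rewrite affmap1].
exists 1%:M, 0; split; [exact: unitmx1 | by rewrite affmap1 |].
apply/seteqP; split=> [_ [p hp <-]|p hp].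
  by rewrite image_id mulmx1; case: p hp.
by exists p => //; rewrite image_id mulmx1; case: p hp.
Qed.

(** Needed to bound the infimum from below. The common target [f1 y] is taken deep enough to
    dominate [z] and [z'] and to lie where both charts agree with [f1]. *)
Lemma Uset_nonempty x x' : Uset D M true (chart_germ D f1) x x' !=set0.
Proof.
have [z [E [e [hE he ef ->]]]] := coordinate_ex x.
have [z' [E' [e' [hE' he' ef' ->]]]] := coordinate_ex x'.
have [y1 h1] := ef; have [y2 h2] := ef'.
have [y3 [y31 y32]] := deep_two D y1 y2; have [y4 [y4z y4z']] := deep_two D z z'.
have [y [y3' y4']] := deep_two D y3 y4.
have dz a b : Cvf D (y - a) -> Cvf D (a - b) -> Cvf D (y - b).
  by move=> ha hb; rewrite -[y](subrK a) -addrA; apply: Cvf_add.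
have germ_at g X z0 : apt M X -> chart M X g -> deep_eq D g f1 -> g y = f1 y ->
    germ_translate D M true (chart_germ D f1) (g z0) (y - z0) (f1 y).
  move=> hX hg gf gy; have inX x0 := chart_in hM x0 hX hg.
  have gE := deep_eq_germ gf.
  exists X, g, z0; split=> //.
    by rewrite -gE; apply/chart_germE; exists 0 => v _; apply: inX.
  split=> //; first exact: model_iso_of_chart.
    by rewrite signed_infty_true.
  by rewrite scale1r subrKC.
have cl u : Cvf D u -> closure (@Cvf R I n D) u by move=> uC; apply: subset_closure.
exists (y - z, y - z'); split; rewrite /=; [exact/cl/(dz y4)|exact/cl/(dz y4)|].
exists (f1 y); split; [apply: (germ_at e E) | apply: (germ_at e' E')] => //.
  by have := h1 _ (dz _ _ y3' y31); rewrite subrKC.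
by have := h2 _ (dz _ _ y3' y32); rewrite subrKC.
Qed.

End Coordinates.

Theorem corollary38 (R : realType) (I : finType) (n : nat)
    (D : root_datum I n) (P : Type) (M : apartment_system R n P)
    (hM : is_masure D M) (hthick : finite_thick D M)
    (G : groupType) (act : G -> P -> P) (hact : is_action act)
    (htrans : strongly_transitive D M act)
    (A0 : set P) (iota : 'rV[R]_n -> P) (hA0 : apt M A0)
    (hiota : chart M A0 iota)
    (hstab : induced_group act A0 iota = weyl_affine D (@Ylattice R n))
    (A : set P) (s : set (set P)) (rho : P -> P)
    (hs : sector_germ D M true s) (hrho : is_retraction D M A s rho)
    (hA : A = range rho)
    (B : set P) (hB : apt M B)
    (dA dB : P -> P -> R)
    (hdA : norm_distance M A dA) (hdB : norm_distance M B dB) :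
  (forall (N : 'rV[R]_n -> R) (t : set (set P)),
      is_norm N -> sector_germ D M true t ->
      lipschitz_map setT (dtheta D M true N t) dA rho) /\
  lipschitz_map B dB dA rho.
Proof.
have [A1 [f1 [hA1 hf1 sE]]] := sector_germ_chart hM hs.
have [fA hfA rhoE] := retraction_position hM hA1 hf1 sE hrho.
have [hAapt _ _] := hrho.
have [fd [NA [hfd hNA dAE]]] := hdA.
have [_ [w [q [hw _ ->]]] fAE] := chart_trans hM hAapt hfd hfA.
pose pos := position D M f1.
have dA_pos x y : dA (rho x) (rho y) = NA ((pos x - pos y) *m w).
  rewrite !rhoE fAE /= dAE /affmap; congr NA.
  by rewrite mulmxBl opprD addrACA subrr addr0.
have hq := seminorm_mulmx w (is_norm_seminorm hNA).
split=> [N t hN ht|]; last first.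
  have [fB [NB [hfB hNB dBE]]] := hdB.
  have [KA KA0 hKA] := seminorm_le_is_norm hq hNB.
  have [K K0 hK] := position_lipschitz hM hA1 hf1 hB hfB hNB.
  exists (KA * K); split; first exact: mulr_ge0.
  move=> _ _ /(chart_surj hM hB hfB)[x <-] /(chart_surj hM hB hfB)[y <-].
  rewrite dA_pos dBE -mulrA; apply: le_trans (hKA _) _.
  by rewrite ler_wpM2l //; apply: (hK _ _ hB hfB erefl).
have [At [ft [hAt hft tE]]] := sector_germ_chart hM ht.
have [KA KA0 hKA] := seminorm_le_is_norm hq hN.
have [K K0 hK] := position_lipschitz hM hA1 hf1 hAt hft hN.
(* Going from [x] to [x +_t u] is a displacement inside an apartment containing [t], with a constant
   independent of that apartment. *)
have step x u y : germ_translate D M true t x u y ->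
    NA ((pos x - pos y) *m w) <= KA * K * N u.
  move=> [E [psi [b [hE _ _ [hpsi psit <- ->]]]]].
  have [f [q0 [hf ft' ->]]] := model_iso_chart hM hE hpsi psit.
  rewrite tE in ft'; rewrite -mulrA; apply: le_trans (hKA _) _.
  rewrite ler_wpM2l //; apply: le_trans (hK _ _ hE hf ft' _ _) _.
  have -> : b + q0 - (b + sgn R true *: u + q0) = - u.
    by rewrite scale1r; apply/rowP => j; rewrite !mxE; ring.
  by rewrite (seminormN u (is_norm_seminorm hN)).
(* Adding 1 makes the constant positive, so that it can be divided out before passing to the
   infimum. *)
have k0 : 0 < KA * K + 1 by rewrite ltr_wpDl // mulr_ge0.
exists (KA * K + 1); split; first exact: ltW.
move=> x y _ _; rewrite dA_pos -ler_pdivrMl //.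
apply: lb_le_inf.
  have [p hp] := Uset_nonempty hM hAt hft x y.
  by exists (N p.1 + N p.2); exists p; rewrite // tE.
move=> _ [[u u'] [_ _ [z [/= hx hy]]] <-]; rewrite ler_pdivrMl //.
(* Pass through the common target [z] of the two displacements. *)
have -> : (pos x - pos y) *m w = (pos x - pos z) *m w - (pos y - pos z) *m w.
  by rewrite -mulmxBl opprB addrA subrK.
apply: le_trans ((is_norm_seminorm hNA).1 _ _) _.
rewrite (seminormN _ (is_norm_seminorm hNA)).
apply: le_trans (lerD (step _ _ _ hx) (step _ _ _ hy)) _.
rewrite -mulrDr ler_wpM2r ?lerDl //.
by rewrite addr_ge0 // (seminorm_ge0 _ (is_norm_seminorm hN)).
Qed.
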